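(* Let $\mathfrak g=(\mathfrak g_0\oplus\mathfrak g_{-1},d,[\cdot,\cdot],l_3)$ be a Lie $2$-algebra. The differentiation of the crossed module of Lie groups $(\mathrm{Aut}^{-1}(\mathfrak g),\mathrm{Aut}^0(\mathfrak g),\partial,\triangleright)$ of automorphisms of $\mathfrak g$ is the crossed module of Lie algebras $(\mathrm{Der}^{-1}(\mathfrak g),\mathrm{Der}^0(\mathfrak g),\bar d,\phi)$ of derivations of $\mathfrak g$.
   Context: All vector spaces are real and finite-dimensional. A Lie $2$-algebra $\mathfrak g=(\mathfrak g_0\oplus\mathfrak g_{-1},d,[\cdot,\cdot],l_3)$ consists of vector spaces $\mathfrak g_0,\mathfrak g_{-1}$, a linear map $d:\mathfrak g_{-1}\to\mathfrak g_0$, a skew-symmetric bilinear bracket with $[x,y]\in\mathfrak g_0$, $[x,a]=-[a,x]\in\mathfrak g_{-1}$, $[a,b]=0$ for $x,y\in\mathfrak g_0$, $a,b\in\mathfrak g_{-1}$, and a skew-symmetric trilinear map $l_3:\wedge^3\mathfrak g_0\to\mathfrak g_{-1}$ such that for all $x,y,z,x_i\in\mathfrak g_0$, $a,b\in\mathfrak g_{-1}$: (a) $d[x,a]=[x,da]$, $[da,b]=[a,db]$; (b) $[[x,y],z]+[[y,z],x]+[[z,x],y]=-dl_3(x,y,z)$, $[[x,y],a]+[[y,a],x]+[[a,x],y]=-l_3(x,y,da)$; (c) $\sum_{i=1}^4(-1)^{i+1}[x_i,l_3(x_1,\dots,\hat x_i,\dots,x_4)]+\sum_{i<j}(-1)^{i+j}l_3([x_i,x_j],x_1,\dots,\hat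 x_i,\dots,\hat x_j,\dots,x_4)=0$. Automorphism side. A Lie $2$-algebra homomorphism $A=(A_0,A_1,A_2):\mathfrak g\to\mathfrak g$ consists of linear maps $A_0\in\mathrm{End}(\mathfrak g_0)$, $A_1\in\mathrm{End}(\mathfrak g_{-1})$ with $d\circ A_1=A_0\circ d$ and $A_2:\wedge^2\mathfrak g_0\to\mathfrak g_{-1}$ such that $A_0[x,y]-[A_0x,A_0y]=dA_2(x,y)$, $A_1[x,a]-[A_0x,A_1a]=A_2(x,da)$, and $[A_0x,A_2(y,z)]+c.p.+l_3(A_0x,A_0y,A_0z)=A_2([x,y],z)+c.p.+A_1l_3(x,y,z)$ ($c.p.$: remaining cyclic permutations of $x,y,z$). $\mathrm{Aut}^0(\mathfrak g)$ is the Lie group of those with $A_0,A_1$ invertible, under $(B\diamond A)_0=B_0A_0$, $(B\diamond A)_1=B_1A_1$, $(B\diamond A)_2=B_2\circ(A_0\times A_0)+B_1\circ A_2$. $\mathrm{Aut}^{-1}(\mathfrak g)$ is the Lie group of units of the monoid $\mathrm{Hom}(\mathfrak g_0,\mathfrak g_{-1})$ with product $\tau\star\tau'=\tau+\tau'+\tau\circ d\circ\tau'$ and identity $0$. Further $\partial(\tau)=(I+d\circ\tau,I+\tau\circ d,l_\tau)$ with $l_\tau(x,y)=\tau[x,y]-[x,\tau y]-[\tau x,y]-[\tau x,d\tau y]$, and $A\triangleright\tau=A_1\circ\tau\circ A_0^{-1}$. Derivation side. $\mathrm{Der}^0(\mathfrak g)$ is the set of triples $(X,l_X)=(X_0,X_1,l_X)$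 with $X_0\in\mathrm{End}(\mathfrak g_0)$, $X_1\in\mathrm{End}(\mathfrak g_{-1})$, $X_0\circ d=d\circ X_1$, and $l_X:\wedge^2\mathfrak g_0\to\mathfrak g_{-1}$ linear such that $dl_X(x,y)=X_0[x,y]-[X_0x,y]-[x,X_0y]$, $l_X(x,da)=X_1[x,a]-[X_0x,a]-[x,X_1a]$, and $X_1l_3(x,y,z)=\big(l_X(x,[y,z])+[x,l_X(y,z)]+l_3(X_0x,y,z)\big)+c.p.(x,y,z)$. Its Lie bracket is $\{(X,l_X),(Y,l_Y)\}=([X_0,Y_0],[X_1,Y_1],L_Xl_Y-L_Yl_X)$ with commutators and $L_X\omega(x,y)=X_1\omega(x,y)-\omega(X_0x,y)-\omega(x,X_0y)$. $\mathrm{Der}^{-1}(\mathfrak g)=\mathrm{Hom}(\mathfrak g_0,\mathfrak g_{-1})$ with Lie bracket $\{\Theta,\Theta'\}=\Theta\circ d\circ\Theta'-\Theta'\circ d\circ\Theta$. The map $\bar d:\mathrm{Der}^{-1}(\mathfrak g)\to\mathrm{Der}^0(\mathfrak g)$ is $\bar d(\Theta)=(d\circ\Theta,\Theta\circ d,l_{\delta(\Theta)})$ with $l_{\delta(\Theta)}(x,y)=\Theta[x,y]-[x,\Theta y]-[\Theta x,y]$, and the action is $\phi_{(X,l_X)}\Theta=X_1\circ\Theta-\Theta\circ X_0$. It is known that these form a crossed module of Lie algebras. The differentiation of a crossed module of Lie groups $(H_1,H_0,\partial,\triangleright)$ is $(\mathrm{Lie}(H_1),\mathrm{Lie}(H_0),\partial_*,\phi)$,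 where $\partial_*$ is the differential of $\partial$ at the identity and $\phi_x(a)=\frac{d}{dt}\frac{d}{ds}\big|_{t=s=0}\exp(tx)\triangleright\exp(sa)$. Tangent spaces at the identity are identified with subspaces of the ambient vector spaces $\mathrm{End}(\mathfrak g_0)\oplus\mathrm{End}(\mathfrak g_{-1})\oplus\mathrm{Hom}(\wedge^2\mathfrak g_0,\mathfrak g_{-1})$ and $\mathrm{Hom}(\mathfrak g_0,\mathfrak g_{-1})$. *)

(* Defs.v *)
From HB Require Import structures.
From mathcomp Require Import all_boot all_order all_algebra.
From mathcomp Require Import ring lra.
From mathcomp Require Import boolp classical_sets reals topology normedtype derive.
Set Implicit Arguments.
Unset Strict Implicit.
Unset Printing Implicit Defensive.
Import Order.TTheory GRing.Theory Num.Theory numFieldNormedType.Exports.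
Local Open Scope classical_set_scope.
Local Open Scope ring_scope.

(* Differential calculus of curves in a finite-dimensional real vector space E.
   A [vectType] carries no topology; the canonical one on E is the one induced
   by the linear functionals, so a curve is differentiable (smooth) iff its
   composite with every linear functional is. *)
Section Curves.
Variables (R : realType) (E : vectType R).

Definition has_velocity (c : R -> E) (t : R) (v : E) : Prop :=
  forall f : 'Hom(E, R^o),
    is_derive t (1 : R) ((fun s => f (c s)) : R -> R) (f v : R).

Definition smooth_curve (c : R -> E) : Prop :=
  forall (f : 'Hom(E, R^o)) (n : nat) (t : R),
    derivable (((fun s => f (c s)) : R -> R)^`(n)%classic) t (1 : R).

(* v is the iterated derivative  d/dt d/ds F(t, s)  at t = s = 0. *)
Definition iterated_velocity (F : R -> R -> E) (v : E) : Prop :=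
  exists w : R -> E,
    (forall t, has_velocity (F t) 0 (w t)) /\ has_velocity w 0 v.

End Curves.

(* A Lie group embedded in a finite-dimensional real vector space E. Its smooth
   structure is the one induced by E, so that only its set of points and its
   group law are recorded; that the set of points is a submanifold and the law
   smooth is not part of the record. The law is a total function on E,
   constrained on the points of the group only. *)
Record embedded_lie_group (R : realType) (E : vectType R) := EmbeddedLieGroup {
  gset : set E;
  gmul : E -> E -> E;
  gone : E;
  gone_in : gset gone;
  gmul_in : forall g h, gset g -> gset h -> gset (gmul g h);
  gmulA : forall g h k, gset g -> gset h -> gset k ->
    gmul g (gmul h k) = gmul (gmul g h) k;
  gmul1g : forall g, gset g -> gmul gone g = g;
  gmulg1 : forall g, gset g -> gmul g gone = g;
  ginv_ex : forall g, gset g ->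
    exists h, [/\ gset h, gmul g h = gone & gmul h g = gone]
}.

Record lie_crossed_module_group (R : realType) (E1 E0 : vectType R) :=
  LieCrossedModuleGroup {
  cmg1 : embedded_lie_group E1;
  cmg0 : embedded_lie_group E0;
  cmg_bd : E1 -> E0;
  cmg_act : E0 -> E1 -> E1;
  cmg_bd_in : forall a, gset cmg1 a -> gset cmg0 (cmg_bd a);
  cmg_bdM : forall a b, gset cmg1 a -> gset cmg1 b ->
    cmg_bd (gmul cmg1 a b) = gmul cmg0 (cmg_bd a) (cmg_bd b);
  cmg_act_in : forall g a, gset cmg0 g -> gset cmg1 a ->
    gset cmg1 (cmg_act g a);
  cmg_act1 : forall a, gset cmg1 a -> cmg_act (gone cmg0) a = a;
  cmg_actM : forall g h a, gset cmg0 g -> gset cmg0 h -> gset cmg1 a ->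
    cmg_act (gmul cmg0 g h) a = cmg_act g (cmg_act h a);
  cmg_act_mul : forall g a b, gset cmg0 g -> gset cmg1 a -> gset cmg1 b ->
    cmg_act g (gmul cmg1 a b) = gmul cmg1 (cmg_act g a) (cmg_act g b);
  (* bd (g . a) = g bd(a) g^-1 *)
  cmg_equivariant : forall g a, gset cmg0 g -> gset cmg1 a ->
    gmul cmg0 (cmg_bd (cmg_act g a)) g = gmul cmg0 g (cmg_bd a);
  (* bd(a) . b = a b a^-1 *)
  cmg_peiffer : forall a b, gset cmg1 a -> gset cmg1 b ->
    gmul cmg1 (cmg_act (cmg_bd a) b) a = gmul cmg1 a b
}.

(* A real Lie algebra carried by a linear subspace of E. *)
Record embedded_lie_algebra (R : realType) (E : vectType R) :=
  EmbeddedLieAlgebra {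
  lset : set E;
  lbr : E -> E -> E;
  lset0 : lset 0;
  lsetP : forall (k : R) x y, lset x -> lset y -> lset (k *: x + y);
  lbr_in : forall x y, lset x -> lset y -> lset (lbr x y);
  lbr_linear : forall (k : R) x y z, lset x -> lset y -> lset z ->
    lbr (k *: x + y) z = k *: lbr x z + lbr y z;
  lbr_skew : forall x y, lset x -> lset y -> lbr x y = - lbr y x;
  lbr_jacobi : forall x y z, lset x -> lset y -> lset z ->
    lbr (lbr x y) z + lbr (lbr y z) x + lbr (lbr z x) y = 0
}.

Record lie_crossed_module_algebra (R : realType) (E1 E0 : vectType R) :=
  LieCrossedModuleAlgebra {
  cma1 : embedded_lie_algebra E1;
  cma0 : embedded_lie_algebra E0;
  cma_bd : E1 -> E0;
  cma_act : E0 -> E1 -> E1;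
  cma_bd_in : forall a, lset cma1 a -> lset cma0 (cma_bd a);
  cma_bd_linear : forall (k : R) a b, lset cma1 a -> lset cma1 b ->
    cma_bd (k *: a + b) = k *: cma_bd a + cma_bd b;
  cma_bd_br : forall a b, lset cma1 a -> lset cma1 b ->
    cma_bd (lbr cma1 a b) = lbr cma0 (cma_bd a) (cma_bd b);
  cma_act_in : forall x a, lset cma0 x -> lset cma1 a ->
    lset cma1 (cma_act x a);
  cma_act_linearl : forall (k : R) x y a,
    lset cma0 x -> lset cma0 y -> lset cma1 a ->
    cma_act (k *: x + y) a = k *: cma_act x a + cma_act y a;
  cma_act_linearr : forall (k : R) x a b,
    lset cma0 x -> lset cma1 a -> lset cma1 b ->
    cma_act x (k *: a + b) = k *: cma_act x a + cma_act x b;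
  cma_act_brl : forall x y a, lset cma0 x -> lset cma0 y -> lset cma1 a ->
    cma_act (lbr cma0 x y) a = cma_act x (cma_act y a) - cma_act y (cma_act x a);
  cma_act_brr : forall x a b, lset cma0 x -> lset cma1 a -> lset cma1 b ->
    cma_act x (lbr cma1 a b) =
      lbr cma1 (cma_act x a) b + lbr cma1 a (cma_act x b);
  cma_equivariant : forall x a, lset cma0 x -> lset cma1 a ->
    cma_bd (cma_act x a) = lbr cma0 x (cma_bd a);
  cma_peiffer : forall a b, lset cma1 a -> lset cma1 b ->
    cma_act (cma_bd a) b = lbr cma1 a b
}.

Section Differentiation.
Variables (R : realType).

Definition tangent_space (E : vectType R) (G : embedded_lie_group E) : set E :=
  [set v | exists c : R -> E,
     [/\ forall t, gset G (c t), smooth_curve c, c 0 = gone G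
       & has_velocity c 0 v]].

(* ex is the exponential map of G: for every tangent vector x at the identity,
   t |-> ex (t x) is the one-parameter subgroup of G with velocity x. *)
Definition is_exponential (E : vectType R) (G : embedded_lie_group E)
    (ex : E -> E) : Prop :=
  forall x, tangent_space G x ->
    [/\ forall t : R, gset G (ex (t *: x)),
        forall s t : R, ex ((s + t) *: x) = gmul G (ex (s *: x)) (ex (t *: x)),
        smooth_curve (fun t => ex (t *: x))
      & has_velocity (fun t => ex (t *: x)) 0 x].

(* L is the Lie algebra of G; the bracket is [x, y] = d/dt Ad(exp(t x)) y at
   t = 0, with Ad(g) the differential at the identity of h |-> g h g^-1. *)
Definition is_lie_algebra_of (E : vectType R) (G : embedded_lie_group E)
    (ex : E -> E) (L : embedded_lie_algebra E) : Prop :=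
  lset L = tangent_space G /\
  forall x y, tangent_space G x -> tangent_space G y ->
    iterated_velocity
      (fun t s : R =>
         gmul G (gmul G (ex (t *: x)) (ex (s *: y))) (ex ((- t) *: x)))
      (lbr L x y).

(* D is the differential at the identity of the map f defined on G. *)
Definition is_differential_at_one (E F : vectType R)
    (G : embedded_lie_group E) (f : E -> F) (D : E -> F) : Prop :=
  forall (c : R -> E) (v : E),
    (forall t, gset G (c t)) -> smooth_curve c -> c 0 = gone G ->
    has_velocity c 0 v ->
    has_velocity (fun t => f (c t)) 0 (D v).

Definition is_differentiation (E1 E0 : vectType R)
    (H : lie_crossed_module_group E1 E0)
    (L : lie_crossed_module_algebra E1 E0) : Prop :=
  exists ex1 ex0,
    [/\ is_exponential (cmg1 H) ex1 /\ is_exponential (cmg0 H) ex0,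
        is_lie_algebra_of (cmg1 H) ex1 (cma1 L),
        is_lie_algebra_of (cmg0 H) ex0 (cma0 L),
        is_differential_at_one (cmg1 H) (cmg_bd H) (cma_bd L)
      & forall x a, tangent_space (cmg0 H) x -> tangent_space (cmg1 H) a ->
          iterated_velocity
            (fun t s : R => cmg_act H (ex0 (t *: x)) (ex1 (s *: a)))
            (cma_act L x a)].

End Differentiation.

(* V0 and V1 are the components of degree 0 and -1. The bracket [x, y] is
   lie2_br0 x y, [x, a] is lie2_br1 x a and [a, x] is - lie2_br1 x a; the
   brackets of two elements of V1 vanish. *)
Record lie2_algebra (R : realType) (V0 V1 : vectType R) := Lie2Algebra {
  lie2_d : 'Hom(V1, V0);
  lie2_br0 : 'Hom(V0, 'Hom(V0, V0));
  lie2_br1 : 'Hom(V0, 'Hom(V1, V1));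
  lie2_l3 : 'Hom(V0, 'Hom(V0, 'Hom(V0, V1)));
  lie2_br0_skew : forall x y, lie2_br0 x y = - lie2_br0 y x;
  lie2_l3_skew12 : forall x y z, lie2_l3 x y z = - lie2_l3 y x z;
  lie2_l3_skew23 : forall x y z, lie2_l3 x y z = - lie2_l3 x z y;
  lie2_d_br1 : forall x a, lie2_d (lie2_br1 x a) = lie2_br0 x (lie2_d a);
  lie2_br1_d : forall a b, lie2_br1 (lie2_d a) b = - lie2_br1 (lie2_d b) a;
  lie2_jacobi0 : forall x y z,
    lie2_br0 (lie2_br0 x y) z + lie2_br0 (lie2_br0 y z) x
      + lie2_br0 (lie2_br0 z x) y
    = - lie2_d (lie2_l3 x y z);
  lie2_jacobi1 : forall x y a,
    lie2_br1 (lie2_br0 x y) a + - lie2_br1 x (lie2_br1 y a)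
      + - lie2_br1 y (- lie2_br1 x a) =
      - lie2_l3 x y (lie2_d a);
  lie2_coherence : forall x1 x2 x3 x4,
    (lie2_br1 x1 (lie2_l3 x2 x3 x4) - lie2_br1 x2 (lie2_l3 x1 x3 x4)
      + lie2_br1 x3 (lie2_l3 x1 x2 x4) - lie2_br1 x4 (lie2_l3 x1 x2 x3))
    + (- lie2_l3 (lie2_br0 x1 x2) x3 x4 + lie2_l3 (lie2_br0 x1 x3) x2 x4
        - lie2_l3 (lie2_br0 x1 x4) x2 x3 - lie2_l3 (lie2_br0 x2 x3) x1 x4
        + lie2_l3 (lie2_br0 x2 x4) x1 x3 - lie2_l3 (lie2_br0 x3 x4) x1 x2) = 0
}.

(* The bilinear map given by f, which has to be bilinear (cf. [bilfunE]). *)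
Definition bilfun (R : realType) (U V W : vectType R) (f : U -> V -> W) :
  'Hom(U, 'Hom(V, W)) := linfun (fun x => linfun (f x)).

Section LinearAux.
Variable R : realType.

Lemma linfunE (U V : vectType R) (f : U -> V) (x : U) :
  linear f -> linfun f x = f x.
Proof.
move=> flin.
pose fL : {linear U -> V} := HB.pack f (GRing.isLinear.Build _ _ _ _ f flin).
exact: (lfunE fL x).
Qed.

Lemma bilfunE (U V W : vectType R) (f : U -> V -> W) x y :
  (forall u, linear (f u)) -> (forall v, linear (f^~ v)) ->
  bilfun f x y = f x y.
Proof.
move=> f2 f1; rewrite /bilfun linfunE ?linfunE// => k u v.
apply/lfunP => w; rewrite add_lfunE scale_lfunE !linfunE//; exact: f1.
Qed.

Lemma vec_eq (V : vectType R) (u v : V) :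
  (forall p : V -> R, (forall a b, p (a + b) = p a + p b) ->
     (forall a, p (- a) = - p a) -> p 0 = 0 ->
     (forall k a, p (k *: a) = k * p a) -> p u = p v) -> u = v.
Proof.
move=> H; rewrite (coord_vbasis (memvf u)) (coord_vbasis (memvf v)).
apply: eq_bigr => i _; congr (_ *: _).
apply: (H (coord (vbasis fullv) i)) => [a b|a||k a].
- by rewrite linearD.
- by rewrite linearN.
- by rewrite linear0.
- by rewrite linearZ.
Qed.

End LinearAux.
(* The identities in l3 needed below, for plain functions in place of the
   bundled linear maps, which are slow to rewrite with. *)
Section LinearIdentities.
Variables (R : realType) (V0 V1 : vectType R).
Variables (b0 : V0 -> V0 -> V0) (b1 : V0 -> V1 -> V1) (m : V0 -> V0 -> V0 -> V1).
Hypothesis b1D : forall x a b, b1 x (a + b) = b1 x a + b1 x b.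
Hypothesis b1N : forall x a, b1 x (- a) = - b1 x a.
Hypothesis mD : forall x u y z, m (x + u) y z = m x y z + m u y z.
Hypothesis mN : forall x y z, m (- x) y z = - m x y z.
Hypothesis m_rot : forall x y z, m x y z = m y z x.

Lemma der_l3_br_aux (X0 Y0 : V0 -> V0) (X1 Y1 : V1 -> V1)
    (lX lY : V0 -> V0 -> V1) :
  (forall a b, X1 (a + b) = X1 a + X1 b) ->
  (forall a b, Y1 (a + b) = Y1 a + Y1 b) ->
  (forall u v w, X1 (b1 u (lY v w)) = lX u (Y0 (b0 v w)) - lX u (b0 (Y0 v) w)
     - lX u (b0 v (Y0 w)) + b1 (X0 u) (lY v w) + b1 u (X1 (lY v w))) ->
  (forall u v w, Y1 (b1 u (lX v w)) = lY u (X0 (b0 v w)) - lY u (b0 (X0 v) w)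
     - lY u (b0 v (X0 w)) + b1 (Y0 u) (lX v w) + b1 u (Y1 (lX v w))) ->
  (forall x y z, X1 (m x y z) =
     (lX x (b0 y z) + b1 x (lX y z) + m (X0 x) y z)
   + (lX y (b0 z x) + b1 y (lX z x) + m (X0 y) z x)
   + (lX z (b0 x y) + b1 z (lX x y) + m (X0 z) x y)) ->
  (forall x y z, Y1 (m x y z) =
     (lY x (b0 y z) + b1 x (lY y z) + m (Y0 x) y z)
   + (lY y (b0 z x) + b1 y (lY z x) + m (Y0 y) z x)
   + (lY z (b0 x y) + b1 z (lY x y) + m (Y0 z) x y)) ->
  let lZ x y := X1 (lY x y) - lY (X0 x) y - lY x (X0 y)
                - (Y1 (lX x y) - lX (Y0 x) y - lX x (Y0 y)) in
  let Z0 x := X0 (Y0 x) - Y0 (X0 x) in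
  forall x y z, X1 (Y1 (m x y z)) - Y1 (X1 (m x y z)) =
     (lZ x (b0 y z) + b1 x (lZ y z) + m (Z0 x) y z)
   + (lZ y (b0 z x) + b1 y (lZ z x) + m (Z0 y) z x)
   + (lZ z (b0 x y) + b1 z (lZ x y) + m (Z0 z) x y).
Proof.
move=> X1D Y1D eX eY hX hY lZ Z0 x y z; rewrite {}/lZ {}/Z0.
rewrite [in LHS]hY [in X in _ - X]hX !X1D !Y1D !eX !eY.
rewrite (hX (Y0 x)) (hX (Y0 y)) (hX (Y0 z)) (hY (X0 x)) (hY (X0 y)) (hY (X0 z)).
rewrite !(b1D, b1N, mD, mN).
have m_rot2 u v w : m u v w = m w u v by rewrite [RHS]m_rot.
rewrite ![m (Y0 _) (X0 _) _]m_rot ![m (Y0 _) _ (X0 _)]m_rot2.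
apply: vec_eq => p pD pN p0 pZ; rewrite !(pD, pN).
ring.
Qed.

Lemma der0_jacobi_aux (X0 Y0 Z0 : V0 -> V0) (X1 Y1 Z1 : V1 -> V1)
    (lX lY lZ : V0 -> V0 -> V1) :
  let add2 l := (forall a b c : V0, l (a + b) c = l a c + l b c :> V1) /\
    (forall a b c : V0, l a (b + c) = l a b + l a c :> V1) in
  let opp2 l := (forall a b : V0, l (- a) b = - l a b :> V1) /\
    (forall a b : V0, l a (- b) = - l a b :> V1) in
  let add1 f := (forall a b : V1, f (a + b) = f a + f b :> V1) /\
    (forall a : V1, f (- a) = - f a :> V1) in
  let c (T : zmodType) (S T : T -> T) x := S (T x) - T (S x) in
  let lb S0 S1 lS T0 T1 lT x y : V1 :=
    S1 (lT x y) - lT (S0 x) y - lT x (S0 y)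
    - (T1 (lS x y) - lS (T0 x) y - lS x (T0 y)) in
  add2 lX -> add2 lY -> add2 lZ -> opp2 lX -> opp2 lY -> opp2 lZ ->
  add1 X1 -> add1 Y1 -> add1 Z1 ->
  forall x y,
  lb (c V0 X0 Y0) (c V1 X1 Y1) (lb X0 X1 lX Y0 Y1 lY) Z0 Z1 lZ x y
  + lb (c V0 Y0 Z0) (c V1 Y1 Z1) (lb Y0 Y1 lY Z0 Z1 lZ) X0 X1 lX x y
  + lb (c V0 Z0 X0) (c V1 Z1 X1) (lb Z0 Z1 lZ X0 X1 lX) Y0 Y1 lY x y = 0.
Proof.
move=> add2 opp2 add1 c lb [X21 X22] [Y21 Y22] [Z21 Z22] [X23 X24] [Y23 Y24]
  [Z23 Z24] [X25 X26] [Y25 Y26] [Z25 Z26] x y; rewrite /lb /c.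
rewrite !(X21, X22, X23, X24, X25, X26, Y21, Y22, Y23, Y24, Y25, Y26,
  Z21, Z22, Z23, Z24, Z25, Z26).
apply: vec_eq => p pD pN p0 pZ; rewrite !(pD, pN, p0); ring.
Qed.

Variables (d : V1 -> V0) (t : V0 -> V1).
Hypothesis tD : forall a b, t (a + b) = t a + t b.
Hypothesis tN : forall a, t (- a) = - t a.
Hypothesis b1Dl : forall x y a, b1 (x + y) a = b1 x a + b1 y a.
Hypothesis b1Nl : forall x a, b1 (- x) a = - b1 x a.
Hypothesis mD2 : forall x u y z, m y (x + u) z = m y x z + m y u z.
Hypothesis mD3 : forall x u y z, m y z (x + u) = m y z x + m y z u.
Hypothesis b0_d_r : forall a y, b0 y (d a) = d (b1 y a).
Hypothesis b1_d : forall a b, b1 (d a) b = - b1 (d b) a.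
Hypothesis J0 : forall x y z,
  b0 (b0 x y) z + b0 (b0 y z) x + b0 (b0 z x) y = - d (m x y z).
Hypothesis J1 : forall x y a,
  b1 (b0 x y) a = - m x y (d a) + b1 x (b1 y a) - b1 y (b1 x a).

Lemma aut_bd_l3_aux :
  let w x y := t (b0 x y) - b1 x (t y) - - b1 y (t x) - - b1 (d (t y)) (t x) in
  let h x := x + d (t x) in
  forall x y z,
  b1 (h x) (w y z) + b1 (h y) (w z x) + b1 (h z) (w x y) + m (h x) (h y) (h z)
  = w (b0 x y) z + w (b0 y z) x + w (b0 z x) y + (m x y z + t (d (m x y z))).
Proof.
move=> w h x y z; rewrite {}/w {}/h.
have E u v s : b1 u (b1 (d (t v)) (t s)) = - b1 u (b1 (d (t s)) (t v)).
  by rewrite b1_d b1N.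
have F u v s : b1 (d (b1 u v)) s = - b1 (d s) (b1 u v) by rewrite b1_d.
have := congr1 t (J0 x y z); rewrite !(tD, tN) => T.
have K1 := J1 x (d (t y)) (t z); have K2 := J1 y (d (t z)) (t x).
have K3 := J1 z (d (t x)) (t y); have K4 := J1 (d (t x)) (d (t y)) (t z).
move: K1 K2 K3 K4; rewrite !b0_d_r F (F y) (F z) (F (d (t x))).
rewrite !(J1, b1D, b1Dl, b1N, b1Nl, mD, mD2, mD3).
have m_rot2 u v s : m u v s = m s u v by rewrite [RHS]m_rot.
rewrite (m_rot z (d _)) (m_rot2 y z) (m_rot2 y (d _)) (m_rot z x).
rewrite (E x z y) (E y x z) (E z y x).
rewrite (E (d (t x)) z y) (E (d (t y)) x z) (E (d (t z)) y x).
move=> K1 K2 K3 K4; apply: vec_eq => p pD pN p0 pZ.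
move: (congr1 p T) (congr1 p K1) (congr1 p K2) (congr1 p K3) (congr1 p K4).
rewrite !(pD, pN); lra.
Qed.

End LinearIdentities.

Arguments der_l3_br_aux {R V0 V1} b0 b1 m _ _ _ _ _ X0 Y0 X1 Y1 lX lY.
Arguments der0_jacobi_aux {R V0 V1} X0 Y0 Z0 X1 Y1 Z1 lX lY lZ.
Arguments aut_bd_l3_aux {R V0 V1} b0 b1 m _ _ _ _ d t.

Section Automorphisms.
Variables (R : realType) (V0 V1 : vectType R) (g : lie2_algebra V0 V1).

Local Notation E0 := ('End(V0) * 'End(V1) * 'Hom(V0, 'Hom(V0, V1)))%type.
Local Notation E1 := 'Hom(V0, V1).
Local Notation d := (lie2_d g).
Local Notation br0 := (lie2_br0 g).
Local Notation br1 := (lie2_br1 g).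
Local Notation l3 := (lie2_l3 g).

(* The homomorphism (A_0, A_1, A_2) is encoded as A = ((A_0, A_1), A_2). *)
Record is_hom (A : E0) : Prop := IsHom {
  hom_skew : forall x y, A.2 x y = - A.2 y x;
  hom_d : (d \o A.1.2 = A.1.1 \o d)%VF;
  hom_br0 : forall x y,
    A.1.1 (br0 x y) - br0 (A.1.1 x) (A.1.1 y) = d (A.2 x y);
  hom_br1 : forall x a,
    A.1.2 (br1 x a) - br1 (A.1.1 x) (A.1.2 a) = A.2 x (d a);
  hom_l3 : forall x y z,
    br1 (A.1.1 x) (A.2 y z) + br1 (A.1.1 y) (A.2 z x) + br1 (A.1.1 z) (A.2 x y)
      + l3 (A.1.1 x) (A.1.1 y) (A.1.1 z)
    = A.2 (br0 x y) z + A.2 (br0 y z) x + A.2 (br0 z x) y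
      + A.1.2 (l3 x y z)
}.

Definition lfun_invertible (V : vectType R) (f : 'End(V)) : Prop :=
  exists h : 'End(V), (f \o h = \1)%VF /\ (h \o f = \1)%VF.

Definition aut0 : set E0 :=
  [set A | [/\ is_hom A, lfun_invertible A.1.1 & lfun_invertible A.1.2]].

Definition aut0_mul (B A : E0) : E0 :=
  ((B.1.1 \o A.1.1)%VF, (B.1.2 \o A.1.2)%VF,
   bilfun (fun x y => B.2 (A.1.1 x) (A.1.1 y) + B.1.2 (A.2 x y))).

Definition aut0_one : E0 := (\1%VF, \1%VF, 0).

Definition aut1_mul (s t : E1) : E1 := s + t + (s \o d \o t)%VF.

Definition aut1 : set E1 :=
  [set t | exists s, aut1_mul t s = 0 /\ aut1_mul s t = 0].

(* Third component: t [x, y] - [x, t y] - [t x, y] - [t x, d (t y)], where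
   [t x, y] = - br1 y (t x) and [t x, d (t y)] = - br1 (d (t y)) (t x). *)
Definition aut_bd (t : E1) : E0 :=
  ((\1 + (d \o t))%VF, (\1 + (t \o d))%VF,
   bilfun (fun x y =>
     t (br0 x y) - br1 x (t y) - - br1 y (t x) - - br1 (d (t y)) (t x))).

(* For invertible f, (f^-1)%VF is the inverse of f (cf. [lfun_invV]). *)
Definition aut_act (A : E0) (t : E1) : E1 := (A.1.2 \o t \o A.1.1^-1)%VF.

Record is_der (X : E0) : Prop := IsDer {
  der_skew : forall x y, X.2 x y = - X.2 y x;
  der_d : (X.1.1 \o d = d \o X.1.2)%VF;
  der_br0 : forall x y,
    d (X.2 x y) = X.1.1 (br0 x y) - br0 (X.1.1 x) y - br0 x (X.1.1 y);
  der_br1 : forall x a,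
    X.2 x (d a) = X.1.2 (br1 x a) - br1 (X.1.1 x) a - br1 x (X.1.2 a);
  der_l3 : forall x y z,
    X.1.2 (l3 x y z)
    = (X.2 x (br0 y z) + br1 x (X.2 y z) + l3 (X.1.1 x) y z)
    + (X.2 y (br0 z x) + br1 y (X.2 z x) + l3 (X.1.1 y) z x)
    + (X.2 z (br0 x y) + br1 z (X.2 x y) + l3 (X.1.1 z) x y)
}.

Definition der0 : set E0 := [set X | is_der X].

(* L_X w for a bilinear map w. *)
Definition der_L (X : E0) (w : V0 -> V0 -> V1) (x y : V0) : V1 :=
  X.1.2 (w x y) - w (X.1.1 x) y - w x (X.1.1 y).

Definition der0_br (X Y : E0) : E0 :=
  (((X.1.1 \o Y.1.1) - (Y.1.1 \o X.1.1))%VF,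
   ((X.1.2 \o Y.1.2) - (Y.1.2 \o X.1.2))%VF,
   bilfun (fun x y => der_L X (fun u v => Y.2 u v) x y
                      - der_L Y (fun u v => X.2 u v) x y)).

Definition der1_br (s t : E1) : E1 := ((s \o d \o t) - (t \o d \o s))%VF.

Definition der_bd (t : E1) : E0 :=
  ((d \o t)%VF, (t \o d)%VF,
   bilfun (fun x y => t (br0 x y) - br1 x (t y) - - br1 y (t x))).

Definition der_act (X : E0) (t : E1) : E1 := ((X.1.2 \o t) - (t \o X.1.1))%VF.

Lemma lfun_invV (V : vectType R) (f h : 'End(V)) :
  (f \o h = \1)%VF -> (h \o f = \1)%VF -> (f^-1)%VF = h.
Proof.
move=> fh hf; have kf : lker f == 0%VS.
  apply/lker0P => x y /(congr1 h).
  by rewrite -!comp_lfunE hf !id_lfunE.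
by rewrite -[LHS]comp_lfun1r -fh comp_lfunA lker0_compVf// comp_lfun1l.
Qed.

Lemma invV (V : vectType R) (f : 'End(V)) : lfun_invertible f ->
  (f \o f^-1 = \1)%VF /\ (f^-1 \o f = \1)%VF.
Proof. by move=> [h [fh hf]]; rewrite (lfun_invV fh hf). Qed.

Lemma lfun_D (U V : vectType R) (f : 'Hom(U, V)) x y : f (x + y) = f x + f y.
Proof. exact: linearD. Qed.

Lemma lfun_N (U V : vectType R) (f : 'Hom(U, V)) x : f (- x) = - f x.
Proof. exact: linearN. Qed.

Lemma lfun_0 (U V : vectType R) (f : 'Hom(U, V)) : f 0 = 0.
Proof. exact: linear0. Qed.

Lemma lfun_Z (U V : vectType R) (f : 'Hom(U, V)) (k : R) x :
  f (k *: x) = k *: f x.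
Proof. exact: linearZ. Qed.

Lemma lfun_addE (U V : vectType R) (f h : 'Hom(U, V)) x :
  (f + h) x = f x + h x.
Proof. exact: add_lfunE. Qed.

Lemma lfun_oppE (U V : vectType R) (f : 'Hom(U, V)) x : (- f) x = - f x.
Proof. exact: opp_lfunE. Qed.

Lemma lfun_scaleE (U V : vectType R) (f : 'Hom(U, V)) (k : R) x :
  (k *: f) x = k *: f x.
Proof. exact: scale_lfunE. Qed.

Lemma lfun_0E (U V : vectType R) x : (0 : 'Hom(U, V)) x = 0.
Proof. exact: zero_lfunE. Qed.

Lemma lfun_compE (U V W : vectType R) (f : 'Hom(V, W)) (h : 'Hom(U, V)) x :
  (f \o h)%VF x = f (h x).
Proof. exact: comp_lfunE. Qed.

Lemma lfun_idE (U : vectType R) (x : U) : (\1%VF : 'End(U)) x = x.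
Proof. exact: id_lfunE. Qed.

Let linE := (lfun_D, lfun_N, lfun_0, lfun_Z, lfun_addE, lfun_oppE,
  lfun_scaleE, lfun_0E, lfun_compE, lfun_idE).

Local Ltac bilin := move=> ? ? ? ?; rewrite /der_L /= !linE; apply: vec_eq;
  let p := fresh in let pD := fresh in let pN := fresh in
  let p0 := fresh in let pZ := fresh in
  move=> p pD pN p0 pZ; rewrite !(pD, pN, p0, pZ); ring.

Lemma aut0_mulE B A x y :
  (aut0_mul B A).2 x y = B.2 (A.1.1 x) (A.1.1 y) + B.1.2 (A.2 x y).
Proof. by apply: bilfunE; bilin. Qed.

Lemma aut_bdE t x y : (aut_bd t).2 x y =
  t (br0 x y) - br1 x (t y) - - br1 y (t x) - - br1 (d (t y)) (t x).
Proof. by apply: bilfunE; bilin. Qed.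

Lemma der0_brE X Y x y : (der0_br X Y).2 x y =
  der_L X (fun u v => Y.2 u v) x y - der_L Y (fun u v => X.2 u v) x y.
Proof. by apply: bilfunE; bilin. Qed.

Lemma der_bdE t x y : (der_bd t).2 x y =
  t (br0 x y) - br1 x (t y) - - br1 y (t x).
Proof. by apply: bilfunE; bilin. Qed.

End Automorphisms.

Section CrossedModules.
Variables (R : realType) (V0 V1 : vectType R) (g : lie2_algebra V0 V1).

Local Notation E0 := ('End(V0) * 'End(V1) * 'Hom(V0, 'Hom(V0, V1)))%type.
Local Notation E1 := 'Hom(V0, V1).
Local Notation d := (lie2_d g).
Local Notation br0 := (lie2_br0 g).
Local Notation br1 := (lie2_br1 g).
Local Notation l3 := (lie2_l3 g).

Let linE := (lfun_D, lfun_N, lfun_0, lfun_Z, lfun_addE, lfun_oppE,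
  lfun_scaleE, lfun_0E, lfun_compE, lfun_idE).

Local Ltac bilin := move=> ? ? ? ?; rewrite /der_L /= !linE; apply: vec_eq;
  let p := fresh in let pD := fresh in let pN := fresh in
  let p0 := fresh in let pZ := fresh in
  move=> p pD pN p0 pZ; rewrite !(pD, pN, p0, pZ); ring.

Local Ltac vecs :=
  let p := fresh "p" in let pD := fresh in let pN := fresh in
  let p0 := fresh in let pZ := fresh in
  apply: vec_eq => p pD pN p0 pZ;
  repeat match goal with H : @eq (_ : Type) _ _ |- _ =>
    apply (congr1 p) in H; revert H end;
  rewrite ?(pD, pN, p0, pZ) => *; lra.

Local Ltac vring :=
  let p := fresh "p" in let pD := fresh in let pN := fresh in
  let p0 := fresh in let pZ := fresh in
  apply: vec_eq => p pD pN p0 pZ; rewrite ?(pD, pN, p0, pZ); ring.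

Lemma E0_eq (A B : E0) : (forall x, A.1.1 x = B.1.1 x) ->
  (forall a, A.1.2 a = B.1.2 a) -> (forall x y, A.2 x y = B.2 x y) -> A = B.
Proof.
case: A => [[A0 A1] A2]; case: B => [[B0 B1] B2] /= /lfunP-> /lfunP-> h2.
by congr (_, _); apply/lfunP => x; apply/lfunP => y.
Qed.

Lemma lfun_invertible_comp (V : vectType R) (f h : 'End(V)) :
  lfun_invertible f -> lfun_invertible h -> lfun_invertible (f \o h)%VF.
Proof.
move=> [f' [ff' f'f]] [h' [hh' h'h]]; exists (h' \o f')%VF.
split; apply/lfunP => x; rewrite !comp_lfunE.
  by rewrite -[h (h' _)]comp_lfunE hh' id_lfunE -[LHS]comp_lfunE ff'.
by rewrite -[f' (f _)]comp_lfunE f'f id_lfunE -[LHS]comp_lfunE h'h.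
Qed.

Lemma hom_dE (A : E0) : is_hom g A -> forall a, d (A.1.2 a) = A.1.1 (d a).
Proof. by move=> /hom_d /lfunP H a; move: (H a); rewrite !comp_lfunE. Qed.

Lemma aut0_mul_hom (B A : E0) : is_hom g B -> is_hom g A -> is_hom g (aut0_mul B A).
Proof.
move=> hB hA; split.
- move=> x y; rewrite !aut0_mulE (hom_skew hB) (hom_skew hA x) !linE; vecs.
- by apply/lfunP => a; rewrite /= !linE (hom_dE hB) (hom_dE hA).
- move=> x y; rewrite aut0_mulE /= !linE (hom_dE hB).
  have := hom_br0 hB (A.1.1 x) (A.1.1 y).
  have := congr1 B.1.1 (hom_br0 hA x y); rewrite !linE => *; vecs.
- move=> x a; rewrite aut0_mulE /= !linE -(hom_dE hA).
  have := hom_br1 hB (A.1.1 x) (A.1.2 a).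
  have := congr1 B.1.2 (hom_br1 hA x a); rewrite !linE => *; vecs.
- move=> x y z; rewrite !aut0_mulE /= !linE.
  have := hom_l3 hB (A.1.1 x) (A.1.1 y) (A.1.1 z).
  have := congr1 B.1.2 (hom_l3 hA x y z); rewrite !linE.
  have e u v w : B.2 (A.1.1 (br0 u v)) (A.1.1 w) =
     B.2 (br0 (A.1.1 u) (A.1.1 v)) (A.1.1 w)
     - (B.1.2 (br1 (A.1.1 w) (A.2 u v)) - br1 (B.1.1 (A.1.1 w)) (B.1.2 (A.2 u v))).
    rewrite (hom_br1 hB) (hom_skew hB _ (d _)) -(hom_br0 hA) !linE; vecs.
  rewrite !e => *; vecs.
Qed.

Lemma aut0_mulA (C B A : E0) : aut0_mul C (aut0_mul B A) = aut0_mul (aut0_mul C B) A.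
Proof.
by apply: E0_eq => *; rewrite ?aut0_mulE /= ?aut0_mulE /= ?linE // addrA.
Qed.

Lemma aut0_mul1l (A : E0) : aut0_mul (aut0_one V0 V1) A = A.
Proof. by apply: E0_eq => *; rewrite ?aut0_mulE /= ?linE // add0r. Qed.

Lemma aut0_mul1r (A : E0) : aut0_mul A (aut0_one V0 V1) = A.
Proof. by apply: E0_eq => *; rewrite ?aut0_mulE /= ?linE // addr0. Qed.

Lemma aut0_one_in : aut0 g (aut0_one V0 V1).
Proof.
split; [split=> /=|..].
- by move=> x y; rewrite !linE oppr0.
- by apply/lfunP => x; rewrite !linE.
- by move=> x y; rewrite !linE subrr.
- by move=> x y; rewrite !linE subrr.
- by move=> x y z; rewrite !linE.
- by exists \1%VF; rewrite comp_lfun1l.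
- by exists \1%VF; rewrite comp_lfun1l.
Qed.

Lemma aut0_mul_in (B A : E0) : aut0 g B -> aut0 g A -> aut0 g (aut0_mul B A).
Proof.
move=> [hB B0 B1] [hA A0 A1]; split; first exact: aut0_mul_hom.
  exact: lfun_invertible_comp.
exact: lfun_invertible_comp.
Qed.

Definition aut0_inv (A : E0) : E0 :=
  ((A.1.1^-1)%VF, (A.1.2^-1)%VF,
   bilfun (fun x y => - (A.1.2^-1)%VF (A.2 ((A.1.1^-1)%VF x) ((A.1.1^-1)%VF y)))).

Lemma aut0_invE A x y : (aut0_inv A).2 x y =
  - (A.1.2^-1)%VF (A.2 ((A.1.1^-1)%VF x) ((A.1.1^-1)%VF y)).
Proof. by apply: bilfunE; bilin. Qed.

Lemma invVE (V : vectType R) (f : 'End(V)) : lfun_invertible f ->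
  (forall x, f ((f^-1)%VF x) = x) /\ (forall x, (f^-1)%VF (f x) = x).
Proof.
by move=> /invV[/lfunP h /lfunP k]; split=> x; [move: (h x)|move: (k x)];
  rewrite !linE.
Qed.

Lemma aut0_inv_mul (A : E0) : aut0 g A ->
  aut0_mul A (aut0_inv A) = aut0_one V0 V1 /\
  aut0_mul (aut0_inv A) A = aut0_one V0 V1.
Proof.
move=> [hA /invVE[k0 i0] /invVE[k1 i1]].
split; apply: E0_eq => *; rewrite ?aut0_mulE ?aut0_invE /= ?linE ?k0 ?k1 ?i0 ?i1//.
  by rewrite subrr.
by rewrite addNr.
Qed.

Lemma aut0_inv_in (A : E0) : aut0 g A -> aut0 g (aut0_inv A).
Proof.
move=> [hA A0 A1]; have [k0 i0] := invVE A0; have [k1 i1] := invVE A1.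
set a0 := (A.1.1^-1)%VF in k0 i0; set a1 := (A.1.2^-1)%VF in k1 i1.
have inv0 : lfun_invertible a0.
  by exists A.1.1; split; apply/lfunP => x; rewrite !linE.
have inv1 : lfun_invertible a1.
  by exists A.1.2; split; apply/lfunP => x; rewrite !linE.
have da a : d (a1 a) = a0 (d a) by rewrite -{2}[a]k1 (hom_dE hA) i0.
split=> //; split=> /=; rewrite -/a0 -/a1.
- by move=> x y; rewrite !aut0_invE -/a0 -/a1 (hom_skew hA) !linE.
- by apply/lfunP => a; rewrite !linE.
- move=> x y; rewrite aut0_invE -/a0 -/a1 !linE da -(hom_br0 hA) !linE !k0 i0.
  vecs.
- move=> x a; rewrite aut0_invE -/a0 -/a1 -da -(hom_br1 hA) !linE !k0 !k1 i1.
  vecs.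
- move=> x y z; rewrite !aut0_invE -/a0 -/a1 !linE.
  have := congr1 a1 (hom_l3 hA (a0 x) (a0 y) (a0 z)).
  rewrite !linE !k0 i1.
  have e u v w : a1 (A.2 (a0 (br0 u v)) (a0 w)) =
      a1 (A.2 (br0 (a0 u) (a0 v)) (a0 w))
      + (br1 (a0 w) (a1 (A.2 (a0 u) (a0 v))) - a1 (br1 w (A.2 (a0 u) (a0 v)))).
    have := congr1 a1 (hom_br1 hA (a0 w) (a1 (A.2 (a0 u) (a0 v)))).
    rewrite !linE k0 k1 i1 (hom_skew hA (a0 w)) da -(hom_br0 hA) !linE !k0 i0 => *.
    vecs.
  by rewrite !e => *; vecs.
Qed.

Definition aut0_group : embedded_lie_group E0.
Proof.
refine (@EmbeddedLieGroup R _ (aut0 g) (@aut0_mul R V0 V1) (aut0_one V0 V1)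
  aut0_one_in aut0_mul_in _ _ _ _).
- by move=> *; exact: aut0_mulA.
- by move=> *; exact: aut0_mul1l.
- by move=> *; exact: aut0_mul1r.
- move=> A hA; exists (aut0_inv A); have [] := aut0_inv_mul hA; split=> //.
  exact: aut0_inv_in.
Defined.

Lemma aut1_mulA (s t u : E1) :
  aut1_mul g s (aut1_mul g t u) = aut1_mul g (aut1_mul g s t) u.
Proof. apply/lfunP => x; rewrite /aut1_mul !linE; vecs. Qed.

Lemma aut1_mul0l (t : E1) : aut1_mul g 0 t = t.
Proof. apply/lfunP => x; rewrite /aut1_mul !linE; vecs. Qed.

Lemma aut1_mul0r (t : E1) : aut1_mul g t 0 = t.
Proof. apply/lfunP => x; rewrite /aut1_mul !linE; vecs. Qed.

Lemma aut1_0 : aut1 g 0.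
Proof. by exists 0; rewrite aut1_mul0l. Qed.

Lemma aut1_mul_in (s t : E1) : aut1 g s -> aut1 g t -> aut1 g (aut1_mul g s t).
Proof.
move=> [s' [ss' s's]] [t' [tt' t't]]; exists (aut1_mul g t' s').
split.
  by rewrite -(aut1_mulA s) (aut1_mulA t) tt' aut1_mul0l.
by rewrite -(aut1_mulA t') (aut1_mulA s') s's aut1_mul0l.
Qed.

Definition aut1_group : embedded_lie_group E1.
Proof.
refine (@EmbeddedLieGroup R _ (aut1 g) (aut1_mul g) 0 aut1_0 aut1_mul_in _ _ _ _).
- by move=> *; exact: aut1_mulA.
- by move=> *; exact: aut1_mul0l.
- by move=> *; exact: aut1_mul0r.
- by move=> s [s' [ss' s's]]; exists s'; split=> //; exists s.
Defined.

Lemma br0_d_l a y : br0 (d a) y = - d (br1 y a).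
Proof. by rewrite lie2_br0_skew lie2_d_br1. Qed.

Lemma br0_d_r a y : br0 y (d a) = d (br1 y a).
Proof. by rewrite lie2_d_br1. Qed.

Lemma l3_rot x y z : l3 x y z = l3 y z x.
Proof. by rewrite lie2_l3_skew12 lie2_l3_skew23 opprK. Qed.

Lemma aut_bd_hom (t : E1) : is_hom g (aut_bd g t).
Proof.
split.
- move=> x y; rewrite !aut_bdE (lie2_br0_skew _ x y) (lie2_br1_d g (t y)) !linE.
  vecs.
- by apply/lfunP => a; rewrite /= !linE.
- move=> x y; rewrite aut_bdE /= !linE !lie2_d_br1.
  by rewrite (lie2_br0_skew _ (d (t x)) y) (lie2_br0_skew _ (d (t x)) (d _)); vecs.
- move=> x a; rewrite aut_bdE /= !linE !lie2_d_br1.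
  by rewrite (lie2_br1_d _ _ a) (lie2_br1_d _ (t x)); vecs.
- move=> x y z; rewrite !aut_bdE /=.
  have e0 u : (\1 + (d \o t))%VF u = u + d (t u) by rewrite !linE.
  have e1 a : (\1 + (t \o d))%VF a = a + t (d a) by rewrite !linE.
  rewrite !e0 e1.
  apply: (aut_bd_l3_aux (fun u v => br0 u v) (fun u a => br1 u a)
    (fun u v w => l3 u v w) _ _ _ _ (fun a => d a) (fun u => t u));
    try by [move=> *; rewrite !linE | exact: l3_rot | exact: br0_d_r
           | exact: lie2_br1_d | exact: lie2_jacobi0].
  move=> u v a; have := lie2_jacobi1 g u v a; rewrite !linE => *; vecs.
Qed.

Lemma aut_bd_mul (s t : E1) :
  aut_bd g (aut1_mul g s t) = aut0_mul (aut_bd g s) (aut_bd g t).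
Proof.
apply: E0_eq => [x|a|x y].
- rewrite /= /aut1_mul !linE; vecs.
- rewrite /= /aut1_mul !linE; vecs.
- rewrite aut0_mulE !aut_bdE /= /aut1_mul !linE.
  rewrite !(br0_d_l, br0_d_r) !linE.
  have := lie2_br1_d g (s y) (t x).
  have := lie2_br1_d g (s (d (t y))) (t x).
  move=> *; vecs.
Qed.

Lemma aut_bd_in (t : E1) : aut1 g t -> aut0 g (aut_bd g t).
Proof.
move=> [s [ts st]]; split; first exact: aut_bd_hom.
  have bd0 : (aut_bd g 0).1.1 = \1%VF by apply/lfunP => x; rewrite /= !linE addr0.
  exists (aut_bd g s).1.1; split.
    by rewrite -bd0 -ts aut_bd_mul.
  by rewrite -bd0 -st aut_bd_mul.
have bd0 : (aut_bd g 0).1.2 = \1%VF by apply/lfunP => x; rewrite /= !linE addr0.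
exists (aut_bd g s).1.2; split.
  by rewrite -bd0 -ts aut_bd_mul.
by rewrite -bd0 -st aut_bd_mul.
Qed.

Lemma aut_act0 (A : E0) : aut_act A 0 = 0 :> E1.
Proof. by apply/lfunP => x; rewrite /aut_act !linE. Qed.

Lemma aut_act_mul (A : E0) (s t : E1) : aut0 g A ->
  aut_act A (aut1_mul g s t) = aut1_mul g (aut_act A s) (aut_act A t).
Proof.
move=> [hA /invVE[k0 i0] _]; apply/lfunP => x.
rewrite /aut_act /aut1_mul !linE (hom_dE hA) i0 //.
Qed.

Lemma aut_act_in (A : E0) (t : E1) : aut0 g A -> aut1 g t ->
  aut1 g (aut_act A t).
Proof.
move=> hA [s [ts st]]; exists (aut_act A s).
by rewrite -!aut_act_mul// ts st aut_act0.
Qed.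

Lemma aut_act1 (t : E1) : aut_act (aut0_one V0 V1) t = t.
Proof.
apply/lfunP => x; rewrite /aut_act (lfun_invV (h := \1%VF)) ?comp_lfun1l//.
by rewrite !linE.
Qed.

Lemma aut_actM (B A : E0) (t : E1) : aut0 g B -> aut0 g A ->
  aut_act (aut0_mul B A) t = aut_act B (aut_act A t).
Proof.
move=> [hB /invVE[k0 i0] _] [hA /invVE[k0' i0'] _]; apply/lfunP => x.
rewrite /aut_act (lfun_invV (h := (A.1.1^-1 \o B.1.1^-1)%VF)) /= ?linE //.
  by apply/lfunP => u; rewrite !linE k0' k0.
by apply/lfunP => u; rewrite !linE i0 i0'.
Qed.

Lemma aut_equivariant (A : E0) (t : E1) : aut0 g A ->
  aut0_mul (aut_bd g (aut_act A t)) A = aut0_mul A (aut_bd g t).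
Proof.
move=> [hA /invVE[k0 i0] /invVE[k1 i1]].
apply: E0_eq => [x|a|x y].
- by rewrite /= /aut_act !linE i0 (hom_dE hA).
- by rewrite /= /aut_act !linE (hom_dE hA) i0.
- rewrite !aut0_mulE !aut_bdE /= /aut_act !linE !i0 !(hom_dE hA).
  have := hom_br1 hA x (t y).
  have := hom_br1 hA y (t x).
  have := hom_br1 hA (d (t y)) (t x).
  have := congr1 (fun u => A.1.2 (t ((A.1.1^-1)%VF u))) (hom_br0 hA x y).
  rewrite !linE -(hom_dE hA) !i0.
  have := hom_skew hA y (d (t x)).
  have := hom_skew hA (d (t x)) (d (t y)).
  move=> *; vecs.
Qed.

Lemma aut_peiffer (s t : E1) : aut1 g s ->
  aut1_mul g (aut_act (aut_bd g s) t) s = aut1_mul g s t.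
Proof.
move=> /aut_bd_in [hA /invVE[k0 i0] _]; apply/lfunP => x.
have := congr1 (fun u => t u) (i0 x).
rewrite /aut1_mul /aut_act.
set b := ((_^-1)%VF); rewrite /= !linE.
move/(congr1 (fun u => u + s (d u))).
rewrite !linE => *; vecs.
Qed.

Definition aut_crossed_module : lie_crossed_module_group E1 E0.
Proof.
refine (@LieCrossedModuleGroup R E1 E0 aut1_group aut0_group (aut_bd g)
  (@aut_act R V0 V1) aut_bd_in _ aut_act_in _ _ _ _ _).
- by move=> *; exact: aut_bd_mul.
- by move=> *; exact: aut_act1.
- by move=> *; exact: aut_actM.
- by move=> *; exact: aut_act_mul.
- by move=> *; exact: aut_equivariant.
- by move=> *; exact: aut_peiffer.
Defined.

Lemma der_dE (X : E0) : is_der g X -> forall a, X.1.1 (d a) = d (X.1.2 a).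
Proof. by move=> /der_d /lfunP H a; move: (H a); rewrite !linE. Qed.

Lemma der0_0 : der0 g 0.
Proof.
split=> /=.
- by move=> *; rewrite !linE oppr0.
- by apply/lfunP => a; rewrite !linE.
- by move=> *; rewrite !linE; vecs.
- by move=> *; rewrite !linE; vecs.
- by move=> *; rewrite !linE; vecs.
Qed.

Lemma der0_P (k : R) (X Y : E0) : der0 g X -> der0 g Y -> der0 g (k *: X + Y).
Proof.
move=> hX hY; split=> /=.
- move=> x y; rewrite !linE (der_skew hX) (der_skew hY).
  by vring.
- by apply/lfunP => a; rewrite !linE (der_dE hX) (der_dE hY).
- move=> x y; rewrite !linE (der_br0 hX) (der_br0 hY).
  by vring.
- move=> x a; rewrite !linE (der_br1 hX) (der_br1 hY).
  by vring.
- move=> x y z.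
  have e1 a : (k *: X.1.2 + Y.1.2) a = k *: X.1.2 a + Y.1.2 a by rewrite !linE.
  have e0 u : (k *: X.1.1 + Y.1.1) u = k *: X.1.1 u + Y.1.1 u by rewrite !linE.
  have e2 u v : (k *: X.2 + Y.2) u v = k *: X.2 u v + Y.2 u v by rewrite !linE.
  have eb u a b : br1 u (k *: a + b) = k *: br1 u a + br1 u b by rewrite !linE.
  have em u v w s : l3 (k *: u + v) w s = k *: l3 u w s + l3 v w s.
    by rewrite !linE.
  rewrite !e1 !e0 !e2 !eb !em (der_l3 hX) (der_l3 hY); vring.
Qed.

Lemma der0_br_in (X Y : E0) : der0 g X -> der0 g Y -> der0 g (der0_br X Y).
Proof.
move=> hX hY; split=> /=.
- move=> x y; rewrite !der0_brE /der_L.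
  rewrite (der_skew hX x) (der_skew hY x) (der_skew hX _ y) (der_skew hY _ y).
  rewrite (der_skew hX x (Y.1.1 y)) (der_skew hY x (X.1.1 y)) !linE; vring.
- by apply/lfunP => a; rewrite !linE !(der_dE hX, der_dE hY).
- move=> x y; rewrite !der0_brE /der_L !linE -!(der_dE hX, der_dE hY).
  rewrite !(der_br0 hX, der_br0 hY) !linE; vecs.
- move=> x a; rewrite !der0_brE /der_L !linE.
  rewrite !(der_dE hX, der_dE hY) !(der_br1 hX, der_br1 hY) !linE; vecs.
- have e (S T : E0) u v w : der0 g S -> der0 g T ->
      S.1.2 (br1 u (T.2 v w)) = S.2 u (T.1.1 (br0 v w))
        - S.2 u (br0 (T.1.1 v) w) - S.2 u (br0 v (T.1.1 w))
        + br1 (S.1.1 u) (T.2 v w) + br1 u (S.1.2 (T.2 v w)).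
    move=> hS hT; have := der_br1 hS u (T.2 v w).
    rewrite (der_br0 hT) !linE => ->; vring.
  move=> x y z; rewrite !der0_brE /der_L.
  have e0 u : ((X.1.1 \o Y.1.1) - (Y.1.1 \o X.1.1))%VF u =
    X.1.1 (Y.1.1 u) - Y.1.1 (X.1.1 u) by rewrite !linE.
  have e1 u : ((X.1.2 \o Y.1.2) - (Y.1.2 \o X.1.2))%VF u =
    X.1.2 (Y.1.2 u) - Y.1.2 (X.1.2 u) by rewrite !linE.
  rewrite !e0 e1.
  apply: (der_l3_br_aux (fun u v => br0 u v) (fun u a => br1 u a)
    (fun u v w => l3 u v w) _ _ _ _ _ (fun u => X.1.1 u) (fun u => Y.1.1 u)
    (fun a => X.1.2 a) (fun a => Y.1.2 a)
    (fun u v => X.2 u v) (fun u v => Y.2 u v));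
    try by [move=> *; rewrite !linE | exact: l3_rot].
  + by move=> *; exact: e.
  + by move=> *; exact: e.
  + exact: (der_l3 hX).
  + exact: (der_l3 hY).
Qed.

Lemma der0_br_linear (k : R) (X Y Z : E0) :
  der0_br (k *: X + Y) Z = k *: der0_br X Z + der0_br Y Z.
Proof.
apply: E0_eq => [x|a|x y] /=.
- rewrite !linE; vring.
- rewrite !linE; vring.
- rewrite !linE !der0_brE /der_L /= !linE.
  vring.
Qed.

Lemma der0_br_skew (X Y : E0) : der0_br X Y = - der0_br Y X.
Proof.
apply: E0_eq => [x|a|x y] /=.
- rewrite !linE; vecs.
- rewrite !linE; vecs.
- rewrite !linE !der0_brE; vecs.
Qed.

Lemma der0_jacobi (X Y Z : E0) :
  der0_br (der0_br X Y) Z + der0_br (der0_br Y Z) X + der0_br (der0_br Z X) Y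
  = 0.
Proof.
apply: E0_eq => [x|a|x y] /=.
- rewrite !linE; vecs.
- rewrite !linE; vecs.
- have e (A B C : 'Hom(V0, 'Hom(V0, V1))) : (A + B + C) x y =
      A x y + B x y + C x y by rewrite !linE.
  rewrite e !zero_lfunE !der0_brE /der_L !der0_brE /der_L /=.
  have e0 (A B : E0) u : ((A.1.1 \o B.1.1) - (B.1.1 \o A.1.1))%VF u =
    A.1.1 (B.1.1 u) - B.1.1 (A.1.1 u) by rewrite !linE.
  have e1 (A B : E0) u : ((A.1.2 \o B.1.2) - (B.1.2 \o A.1.2))%VF u =
    A.1.2 (B.1.2 u) - B.1.2 (A.1.2 u) by rewrite !linE.
  rewrite !e0 !e1.
  apply: (der0_jacobi_aux (fun u => X.1.1 u) (fun u => Y.1.1 u)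
    (fun u => Z.1.1 u) (fun u => X.1.2 u) (fun u => Y.1.2 u)
    (fun u => Z.1.2 u) (fun u v => X.2 u v) (fun u v => Y.2 u v)
    (fun u v => Z.2 u v));
    by split=> *; rewrite !linE.
Qed.

Definition der0_algebra : embedded_lie_algebra E0.
Proof.
refine (@EmbeddedLieAlgebra R _ (der0 g) (@der0_br R V0 V1)
  der0_0 der0_P der0_br_in _ _ _).
- by move=> *; exact: der0_br_linear.
- by move=> *; exact: der0_br_skew.
- by move=> *; exact: der0_jacobi.
Defined.

Definition der1_algebra : embedded_lie_algebra E1.
Proof.
refine (@EmbeddedLieAlgebra R _ setT (der1_br g) _ _ _ _ _ _) => //.
- move=> k s t u _ _ _; apply/lfunP => x; rewrite /der1_br !linE.
  by vring.
- by move=> s t _ _; apply/lfunP => x; rewrite /der1_br !linE; vecs.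
- by move=> s t u _ _ _; apply/lfunP => x; rewrite /der1_br !linE; vecs.
Defined.

Lemma der_bd_in (t : E1) : der0 g (der_bd g t).
Proof.
split=> /=.
- move=> x y; rewrite !der_bdE (lie2_br0_skew _ x y) !linE; vecs.
- by apply/lfunP => a; rewrite !linE.
- move=> x y; rewrite !der_bdE !linE !(br0_d_l, br0_d_r); vecs.
- move=> x a; rewrite !der_bdE !linE (lie2_br1_d _ (t x)) !(br0_d_l, br0_d_r).
  vecs.
- move=> x y z; rewrite !der_bdE !linE.
  have := congr1 t (lie2_jacobi0 g x y z).
  have := lie2_jacobi1 g x y (t z).
  have := lie2_jacobi1 g y z (t x).
  have := lie2_jacobi1 g z x (t y).
  rewrite (l3_rot (d (t x))) (l3_rot (d (t y))) (l3_rot (d (t z))).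
  rewrite (lie2_br0_skew _ x (br0 _ _)) (lie2_br0_skew _ y (br0 _ _))
    (lie2_br0_skew _ z (br0 _ _)) !linE => *.
  vecs.
Qed.

Lemma der_bd_linear (k : R) (s t : E1) :
  der_bd g (k *: s + t) = k *: der_bd g s + der_bd g t.
Proof.
apply: E0_eq => [x|a|x y]; rewrite ?der_bdE /= ?linE //.
rewrite !der_bdE ?linE.
by vring.
Qed.

Lemma der_bd_br (s t : E1) :
  der_bd g (der1_br g s t) = der0_br (der_bd g s) (der_bd g t).
Proof.
apply: E0_eq => [x|a|x y].
- by rewrite /= /der1_br !linE.
- by rewrite /= /der1_br !linE.
- rewrite der0_brE /der_L !der_bdE /= /der1_br !linE !(br0_d_l, br0_d_r) !linE.
  rewrite (lie2_br1_d g (s x)) (lie2_br1_d g (s y)).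
  vecs.
Qed.

Lemma der_act_brl (X Y : E0) (t : E1) :
  der_act (der0_br X Y) t = der_act X (der_act Y t) - der_act Y (der_act X t).
Proof. by apply/lfunP => x; rewrite /der_act /= !linE; vecs. Qed.

Lemma der_act_brr (X : E0) (s t : E1) : der0 g X ->
  der_act X (der1_br g s t) =
  der1_br g (der_act X s) t + der1_br g s (der_act X t).
Proof.
move=> hX; apply/lfunP => x; rewrite /der_act /der1_br /= !linE.
rewrite !(der_dE hX); vecs.
Qed.

Lemma der_equivariant (X : E0) (t : E1) : der0 g X ->
  der_bd g (der_act X t) = der0_br X (der_bd g t).
Proof.
move=> hX; apply: E0_eq => [x|a|x y].
- by rewrite /= /der_act !linE (der_dE hX).
- by rewrite /= /der_act !linE (der_dE hX).
- rewrite der0_brE /der_L !der_bdE /= /der_act !linE.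
  have := congr1 t (der_br0 hX x y); have := der_br1 hX x (t y).
  have := der_br1 hX y (t x); have := der_skew hX (d (t x)) y.
  rewrite !linE => *; vecs.
Qed.

Lemma der_peiffer (s t : E1) : der_act (der_bd g s) t = der1_br g s t.
Proof. by apply/lfunP => x; rewrite /der_act /der1_br /= !linE. Qed.

Definition der_crossed_module : lie_crossed_module_algebra E1 E0.
Proof.
refine (@LieCrossedModuleAlgebra R E1 E0 der1_algebra der0_algebra (der_bd g)
  (@der_act R V0 V1) _ _ _ _ _ _ _ _ _ _) => //=.
- by move=> *; exact: der_bd_in.
- by move=> *; exact: der_bd_linear.
- by move=> *; exact: der_bd_br.
- move=> k X Y t _ _ _; apply/lfunP => x; rewrite /der_act /= !linE.
  by vring.
- move=> k X s t _ _ _; apply/lfunP => x; rewrite /der_act /= !linE.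
  by vring.
- by move=> *; exact: der_act_brl.
- by move=> *; exact: der_act_brr.
- by move=> *; exact: der_equivariant.
- by move=> *; exact: der_peiffer.
Defined.

End CrossedModules.

(* Main.v *)
(* Although the group law of Aut^0 is quadratic in its right factor, it is
   linear in its left one, so the left-invariant vector field of X is linear on
   the ambient space; that of Aut^{-1} is affine. The exponential maps are thus
   flows of linear vector fields, and the one-parameter property follows from
   uniqueness of solutions. Each homomorphism equation for A(t) has the form
   Q(t) = 0 with Q multilinear, and the derivation equations for X say exactly
   that Q'(t) is the sum of the Q(t) with X inserted in one argument; as
   Q(0) = 0, this forces Q = 0. Conversely, differentiating the homomorphism
   equations along any curve through the identity gives the derivation
   equations. *)
Require Import Defs.
From mathcomp Require Import all_boot all_order all_algebra.
From mathcomp Require Import reals.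
From mathcomp Require Import ring lra.
From mathcomp Require Import boolp classical_sets functions topology normedtype.
From mathcomp Require Import sequences derive realfun exp.
Set Implicit Arguments.
Unset Strict Implicit.
Unset Printing Implicit Defensive.
Import Order.TTheory GRing.Theory Num.Theory numFieldNormedType.Exports.
Local Open Scope classical_set_scope.
Local Open Scope ring_scope.

(** * Velocities of curves *)

Section Velocity.
Variable R : realType.
Implicit Types (E F G U V W : vectType R).

Lemma functional_coord E F (f : 'Hom(E, F)) v :
  f v = \sum_i coord (vbasis fullv) i v *: f (vbasis fullv)`_i.
Proof.
rewrite {1}(coord_vbasis (memvf v)) linear_sum.
by apply: eq_bigr => i _; rewrite linearZ.
Qed.

(** Velocities are defined through functionals, so identities between vectors are tested the same
    way below. *)
Lemma vector_eq_functional E (u v : E) :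
  (forall f : 'Hom(E, R^o), f u = f v) -> u = v.
Proof.
move=> H; apply: vec_eq => p pD pN p0 pZ.
have pl : linear (p : E -> R^o) by move=> k a b; rewrite pD pZ.
by have := H (linfun (p : E -> R^o)); rewrite !linfunE.
Qed.

Lemma has_velocity_const E (v : E) (t : R) : has_velocity (fun=> v) t 0.
Proof. by move=> f; rewrite linear0; exact: is_derive_cst. Qed.

Lemma has_velocityD E (c e : R -> E) (t : R) v w :
  has_velocity c t v -> has_velocity e t w ->
  has_velocity (fun s => c s + e s) t (v + w).
Proof.
move=> hc he f; rewrite linearD.
under eq_fun do rewrite linearD.
exact: is_deriveD (hc f) (he f).
Qed.

Lemma has_velocity_lin E F (L : 'Hom(E, F)) (c : R -> E) (t : R) v :
  has_velocity c t v -> has_velocity (fun s => L (c s)) t (L v).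
Proof.
move=> hc f; have := hc (f \o L)%VF.
rewrite comp_lfunE.
rewrite (_ : (fun s => (f \o L)%VF (c s)) = (fun s => f (L (c s))))//.
by apply/funext => s; rewrite comp_lfunE.
Qed.

Lemma smooth_curve_lin E F (L : 'Hom(E, F)) (c : R -> E) :
  smooth_curve c -> smooth_curve (fun s => L (c s)).
Proof.
move=> hc f n t; have := hc (f \o L)%VF n t.
rewrite (_ : (fun s => (f \o L)%VF (c s)) = (fun s => f (L (c s))))//.
by apply/funext => s; rewrite comp_lfunE.
Qed.

Lemma has_velocityN E (c : R -> E) (t : R) v :
  has_velocity c t v -> has_velocity (fun s => - c s) t (- v).
Proof.
move=> hc f; rewrite linearN.
under eq_fun do rewrite linearN.
exact: is_deriveN (hc f).
Qed.

Lemma has_velocity_sum E n (c : 'I_n -> R -> E) (t : R) (v : 'I_n -> E) :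
  (forall i, has_velocity (c i) t (v i)) ->
  has_velocity (fun s => \sum_i c i s) t (\sum_i v i).
Proof.
elim: n c v => [|n IH] c v h.
  rewrite big_ord0; under eq_fun do rewrite big_ord0.
  exact: has_velocity_const.
rewrite big_ord_recl; under eq_fun do rewrite big_ord_recl.
apply: has_velocityD; first exact: h.
by apply: IH => i; exact: h.
Qed.

Lemma has_velocityZ E (k : R -> R) (c : R -> E) (t k' : R) v :
  is_derive t (1 : R) k k' -> has_velocity c t v ->
  has_velocity (fun s => k s *: c s) t (k' *: c t + k t *: v).
Proof.
move=> hk hc f; rewrite linearD !linearZ /=.
have -> : (fun s => f (k s *: c s)) = k * (fun s => f (c s) : R).
  by apply/funext => s; rewrite linearZ.
apply: is_derive_eq; first exact: (is_deriveM hk (hc f)).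
by rewrite addrC [f (c t) *: _]mulrC.
Qed.

Lemma is_derive_coord E (c : R -> E) (t : R) v i : has_velocity c t v ->
  is_derive t (1 : R) ((fun s => coord (vbasis fullv) i (c s)) : R -> R)
    (coord (vbasis fullv) i v).
Proof.
have lc : linear (coord (vbasis fullv) i : E -> R^o) by exact: linearP.
move=> /(_ (linfun (coord (vbasis fullv) i : E -> R^o))).
rewrite linfunE//; congr is_derive.
by apply/funext => s; rewrite linfunE.
Qed.

(* The product rule for a family of linear maps q_s applied to a moving vector,
   the former being differentiated pointwise only. *)
Lemma has_velocity_app_fun U W (q : R -> U -> W) (q' : U -> W) (u : R -> U)
    (t : R) u' :
  (forall s, linear (q s)) -> linear q' ->
  (forall x, has_velocity (fun s => q s x) t (q' x)) ->
  has_velocity u t u' ->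
  has_velocity (fun s => q s (u s)) t (q' (u t) + q t u').
Proof.
move=> ql q'l hq hu.
(* Expanding the argument in a basis turns [q s (u s)] into a finite sum of scalar coordinates times
   the curves of values at basis vectors, where the product rule with a scalar factor is enough. *)
have qE s x : q s x = \sum_i coord (vbasis fullv) i x *: q s (vbasis fullv)`_i.
  rewrite -(linfunE x (ql s)) functional_coord.
  by apply: eq_bigr => i _; rewrite linfunE.
have q'E x : q' x = \sum_i coord (vbasis fullv) i x *: q' (vbasis fullv)`_i.
  rewrite -(linfunE x q'l) functional_coord.
  by apply: eq_bigr => i _; rewrite linfunE.
rewrite q'E [q t u']qE addrC -big_split /=.
under eq_fun do rewrite qE.
apply: has_velocity_sum => i; apply: has_velocityZ => //.
exact: is_derive_coord.
Qed.

(** In finite dimension a linear map is the sum, over a basis, of the rank-one maps [iota i] built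
    from its values on that basis. Pointwise velocities therefore assemble into a velocity in the
    space of maps. *)
Lemma has_velocity_lfun U W (c : R -> 'Hom(U, W)) (t : R) (v : 'Hom(U, W)) :
  (forall x, has_velocity (fun s => c s x) t (v x)) -> has_velocity c t v.
Proof.
move=> h.
pose iota i (w : W) : 'Hom(U, W) :=
  linfun (fun x => coord (vbasis (fullv : {vspace U})) i x *: w).
have iotaE i w x : iota i w x = coord (vbasis fullv) i x *: w.
  by rewrite linfunE// => k a b; rewrite linearP scalerDl scalerA.
have iotal i : linear (iota i).
  move=> k a b; apply/lfunP => x.
  by rewrite add_lfunE scale_lfunE !iotaE scalerDr !scalerA mulrC.
have e (f : 'Hom(U, W)) : f = \sum_i linfun (iota i) (f (vbasis fullv)`_i).
  apply/lfunP => x; rewrite sum_lfunE functional_coord.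
  by apply: eq_bigr => i _; rewrite linfunE// iotaE.
rewrite (e v) (_ : c = fun s => \sum_i linfun (iota i) (c s (vbasis fullv)`_i)).
  by apply: has_velocity_sum => i; exact/has_velocity_lin/h.
by apply/funext => s; exact: e.
Qed.

Lemma has_velocity_eval U W (q : R -> 'Hom(U, W)) q' (x : U) (t : R) :
  has_velocity q t q' -> has_velocity (fun s => q s x) t (q' x).
Proof.
move=> hq; have xl : linear (fun f : 'Hom(U, W) => f x).
  by move=> k a b; rewrite add_lfunE scale_lfunE.
have := has_velocity_lin (linfun (fun f : 'Hom(U, W) => f x)) hq.
rewrite linfunE//; congr has_velocity.
by apply/funext => s; rewrite linfunE.
Qed.

Lemma has_velocity_app U W (q : R -> 'Hom(U, W)) q' (u : R -> U) (t : R) u' :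
  has_velocity q t q' -> has_velocity u t u' ->
  has_velocity (fun s => q s (u s)) t (q' (u t) + q t u').
Proof.
move=> hq hu; apply: (has_velocity_app_fun (q := fun s x => q s x)) => //.
- by move=> s; exact: linearP.
- exact: linearP.
- by move=> x; exact: has_velocity_eval.
Qed.

Lemma has_velocity_fst E F (c : R -> E * F) (t : R) v :
  has_velocity c t v -> has_velocity (fun s => (c s).1) t v.1.
Proof.
have l : linear (fst : E * F -> E) by [].
move=> /(has_velocity_lin (linfun (fst : E * F -> E))).
rewrite linfunE//; congr has_velocity.
by apply/funext => s; rewrite linfunE.
Qed.

Lemma has_velocity_snd E F (c : R -> E * F) (t : R) v :
  has_velocity c t v -> has_velocity (fun s => (c s).2) t v.2.
Proof.
have l : linear (snd : E * F -> F) by [].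
move=> /(has_velocity_lin (linfun (snd : E * F -> F))).
rewrite linfunE//; congr has_velocity.
by apply/funext => s; rewrite linfunE.
Qed.

Lemma has_velocity_pair E F (c : R -> E * F) (t : R) v :
  has_velocity (fun s => (c s).1) t v.1 ->
  has_velocity (fun s => (c s).2) t v.2 -> has_velocity c t v.
Proof.
have l1 : linear (fun a : E => (a, 0) : E * F).
  by move=> k a b; congr (_, _); rewrite /= scaler0 addr0.
have l2 : linear (fun b : F => (0, b) : E * F).
  by move=> k a b; congr (_, _); rewrite /= scaler0 addr0.
move=> h1 h2; have := has_velocityD
  (has_velocity_lin (linfun (fun a : E => (a, 0) : E * F)) h1)
  (has_velocity_lin (linfun (fun b : F => (0, b) : E * F)) h2).
have e (u : E * F) : linfun (fun a : E => (a, 0) : E * F) u.1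
    + linfun (fun b : F => (0, b) : E * F) u.2 = u.
  rewrite !linfunE//; case: u => a b; apply/eqP.
  by rewrite xpair_eqE /= addr0 add0r !eqxx.
by rewrite e; congr has_velocity; apply/funext => s; exact: e.
Qed.

Lemma has_velocity_comp E (c : R -> E) (k : R -> R) (t k' : R) v :
  is_derive t (1 : R) k k' -> has_velocity c (k t) v ->
  has_velocity (fun s => c (k s)) t (k' *: v).
Proof.
move=> hk hc f; rewrite linearZ /= [_ *: _]mulrC.
exact: (@is_derive1_comp R (fun s => f (c s)) k).
Qed.

Lemma has_velocity_shift E (c : R -> E) (a t : R) v :
  has_velocity c (a + t) v -> has_velocity (fun s => c (a + s)) t v.
Proof.
move=> h; rewrite -[v]scale1r.
apply: (has_velocity_comp (k := fun s => a + s)) h.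
rewrite -[1 in X in is_derive _ _ _ X]add0r.
exact: is_deriveD (is_derive_cst _ _ _) (is_derive_id _ _).
Qed.

Lemma has_velocity_reverse E (c : R -> E) (a t : R) v :
  has_velocity c (a - t) v -> has_velocity (fun s => c (a - s)) t (- v).
Proof.
move=> h; rewrite -scaleN1r; apply: (has_velocity_comp (k := fun s => a - s)) h.
rewrite -sub0r.
exact: is_deriveB (is_derive_cst _ _ _) (is_derive_id _ _).
Qed.

Lemma has_velocity_unique E (c : R -> E) (t : R) v w :
  has_velocity c t v -> has_velocity c t w -> v = w.
Proof.
move=> hv hw; apply: vector_eq_functional => f.
by have [_ <-] := hv f; have [_ <-] := hw f.
Qed.

Lemma has_velocity0_const E (c : R -> E) :
  (forall t, has_velocity c t 0) -> forall s t, c s = c t.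
Proof.
move=> h s t; apply: vector_eq_functional => f.
apply: (@is_derive_0_is_cst R (fun s => f (c s))) => x.
by have := h x f; rewrite linear0.
Qed.

End Velocity.

(** * Linear differential equations *)

Section LinearFlow.
Variables (R : realType) (E : vectType R).
Implicit Types (T : 'End(E)) (f : 'Hom(E, R^o)) (u : E).

(** The Taylor coefficients of t |-> f (exp (t T) u). Pairing with a functional first keeps every
    series scalar. *)
Definition flow_coef T f u (n : nat) : R := (n`!%:R)^-1 * (f (iter n T u) : R).

Lemma iter_lin_linear T n : linear (iter n T : E -> E).
Proof. by elim: n => [|n IH] k a b //; rewrite !iterS IH linearP. Qed.

(** The factor n + 1 produced by formal differentiation cancels against (n + 1)!, leaving one more T
    on u. *)
Lemma flow_coefS T f u :
  pseries_diffs (flow_coef T f u) = flow_coef T f (T u).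
Proof.
apply/funext => n; rewrite /pseries_diffs /flow_coef iterSr factS natrM invfM.
by rewrite !mulrA mulfV ?mul1r// pnatr_eq0.
Qed.

(** In the l1 norm [N] of the coordinates, T stretches by at most [K], the sum of the absolute
    values of its matrix entries. Iterates thus grow at most geometrically, and the series of the
    flow is dominated by an exponential series. *)
Lemma iter_lin_bound T f u :
  exists C K : R, [/\ 0 <= C, 0 <= K &
    forall n, `|f (iter n T u) : R| <= C * K ^+ n].
Proof.
pose b := vbasis (fullv : {vspace E}).
pose N (v : E) : R := \sum_i `|coord b i v|.
have N0 v : 0 <= N v by apply: sumr_ge0.
have lin_le (g : 'Hom(E, R^o)) v :
    `|g v : R| <= (\sum_(i < \dim {:E}) `|g b`_i : R|) * N v.
  rewrite functional_coord mulr_suml.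
  apply: (le_trans (ler_norm_sum _ _ _)); apply: ler_sum => i _.
  rewrite normrM mulrC ler_wpM2l// /N (bigD1 i)//= lerDl; exact: sumr_ge0.
pose K := \sum_(i < \dim {:E}) \sum_(j < \dim {:E}) `|coord b i (T b`_j)|.
have K0 : 0 <= K by do 2!apply: sumr_ge0 => ? _.
have NT v : N (T v) <= K * N v.
  rewrite /N /K mulr_suml; apply: ler_sum => i _.
  have l : linear (fun v => coord b i (T v) : R^o).
    by move=> k x y; rewrite !linearP.
  have := lin_le (linfun (fun v => coord b i (T v) : R^o)) v.
  rewrite linfunE//; congr (_ <= _ * _).
  by apply: eq_bigr => j _; rewrite linfunE.
exists ((\sum_(i < \dim {:E}) `|f b`_i : R|) * N u), K; split=> // [|n].
  by rewrite mulr_ge0// sumr_ge0.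
apply: (le_trans (lin_le _ _)); rewrite -mulrA ler_wpM2l ?sumr_ge0//.
elim: n => [|n IH]; first by rewrite mulr1.
rewrite iterS exprS mulrCA; apply: (le_trans (NT _)).
by rewrite ler_wpM2l.
Qed.

Lemma is_cvg_flow T f u (t : R) : cvgn (pseries (flow_coef T f u) t).
Proof.
have [C [K [C0 K0 h]]] := iter_lin_bound T f u.
apply: normed_cvg; rewrite /normed_series_of /=.
apply: (@series_le_cvg _ _ (fun n => C * exp_coeff (K * `|t|) n)).
- by [].
- by move=> n; rewrite mulr_ge0// exp_coeff_ge0// mulr_ge0.
- move=> n; rewrite /flow_coef /exp_coeff /= !normrM normfV normr_nat.
  rewrite exprMn normrX mulrC mulrA -[leRHS]mulrA mulrA [_ * `|f _|]mulrC.
  rewrite mulrA mulrA ler_wpM2r ?invr_ge0//.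
  by rewrite mulrC ler_wpM2r// exprn_ge0.
- have := @is_cvg_seriesZ R (exp_coeff (K * `|t|)) C
    (is_cvg_series_exp_coeff _).
  by [].
Qed.

Definition flow_fun T f u (t : R) : R := limn (pseries (flow_coef T f u) t).

Lemma is_derive_flow_fun T f u (t : R) :
  is_derive t (1 : R) (flow_fun T f u) (flow_fun T f (T u) t).
Proof.
rewrite /flow_fun -flow_coefS.
(* Any radius larger than |t| will do, since the series and its first two formal derivatives
   converge everywhere. *)
apply: (@pseries_snd_diffs _ _ (`|t| + 1)); rewrite ?flow_coefS;
  try exact: is_cvg_flow.
by rewrite [ltRHS]ger0_norm ?addr_ge0// ltrDl.
Qed.

(* exp(tT)u *)
Definition lin_flow T (t : R) u : E :=
  \sum_i flow_fun T (linfun (coord (vbasis fullv) i : E -> R^o)) u t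
     *: (vbasis fullv)`_i.

(** Frees the flow from the chosen basis: f is a combination of coordinates, and the finite sum
    commutes with the limit. Most later facts about the flow are checked on functionals through this
    identity. *)
Lemma functional_lin_flow f T (t : R) u : f (lin_flow T t u) = flow_fun T f u t.
Proof.
rewrite /lin_flow linear_sum /=; apply/esym; rewrite [LHS]/flow_fun.
have cl i : linear (coord (vbasis fullv) i : E -> R^o) by exact: linearP.
have -> : pseries (flow_coef T f u) t = fun n => \sum_i
   pseries (flow_coef T (linfun (coord (vbasis fullv) i : E -> R^o)) u) t n
     * (f (vbasis fullv)`_i : R).
  apply/funext => n; rewrite /pseries /series /=.
  under [RHS]eq_bigr do rewrite mulr_suml.
  rewrite exchange_big /=; apply: eq_bigr => k _.
  rewrite /flow_coef (functional_coord f) mulr_sumr mulr_suml.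
  apply: eq_bigr => i _.
  by rewrite linfunE// /GRing.scale /= !mulrA [LHS]mulrAC.
under [RHS]eq_bigr do rewrite linearZ.
apply/cvg_lim => //; apply: cvg_big => [|i _]; first exact: add_continuous.
by apply: cvgM; [exact: is_cvg_flow|exact: cvg_cst].
Qed.

Lemma flow_funP T f (t k : R) u v :
  flow_fun T f (k *: u + v) t = k * flow_fun T f u t + flow_fun T f v t.
Proof.
rewrite /flow_fun.
have -> : pseries (flow_coef T f (k *: u + v)) t = fun n =>
    k * pseries (flow_coef T f u) t n + pseries (flow_coef T f v) t n.
  apply/funext => n; rewrite /pseries /series /= mulr_sumr -big_split /=.
  apply: eq_bigr => i _.
  rewrite /flow_coef iter_lin_linear linearP /= /GRing.scale /=; ring.
apply/cvg_lim => //; apply: cvgD; last exact: is_cvg_flow.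
by apply: cvgM; [exact: cvg_cst|exact: is_cvg_flow].
Qed.

Lemma lin_flow_linear T (t : R) : linear (lin_flow T t).
Proof.
move=> k u v; apply: vector_eq_functional => f.
by rewrite [RHS]linearP /= !functional_lin_flow flow_funP.
Qed.

Lemma flow_funT T f u (t : R) :
  flow_fun T (f \o T)%VF u t = flow_fun T f (T u) t.
Proof.
rewrite /flow_fun (_ : flow_coef T (f \o T)%VF u = flow_coef T f (T u))//.
by apply/funext => n; rewrite /flow_coef comp_lfunE -iterS iterSr.
Qed.

Lemma lin_flow_commute T (t : R) u : lin_flow T t (T u) = T (lin_flow T t u).
Proof.
apply: vector_eq_functional => f.
by rewrite -comp_lfunE !functional_lin_flow flow_funT.
Qed.

Lemma has_velocity_lin_flow T u (t : R) :
  has_velocity (fun s => lin_flow T s u) t (T (lin_flow T t u)).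
Proof.
move=> f; rewrite -lin_flow_commute functional_lin_flow.
under eq_fun do rewrite functional_lin_flow.
exact: is_derive_flow_fun.
Qed.

Lemma smooth_lin_flow T u : smooth_curve (fun t => lin_flow T t u).
Proof.
move=> f n t.
have -> : (fun s => f (lin_flow T s u)) = flow_fun T f u.
  by apply/funext => s; rewrite functional_lin_flow.
have -> : (flow_fun T f u)^`(n)%classic = flow_fun T f (iter n T u).
  elim: n => [|n IH]//; rewrite derive1nS IH; apply/funext => s.
  by rewrite derive1E; have [_ ->] := is_derive_flow_fun T f (iter n T u) s.
by have [] := is_derive_flow_fun T f (iter n T u) t.
Qed.

Lemma lin_flow0 T u : lin_flow T 0 u = u.
Proof.
apply: vector_eq_functional => f; rewrite functional_lin_flow /flow_fun.
(* The shift by one discards the empty partial sum, which is 0. In all others only the term of index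
   0 survives, with 0 ^+ 0 = 1. *)
apply/cvg_lim => //; rewrite -(cvg_shiftS _).
apply: cvg_near_cst; near=> n; rewrite /pseries /series /=.
rewrite big_nat_recl//= big1 => [|i _]; last by rewrite exprS mul0r mulr0.
by rewrite addr0 expr0 mulr1 /flow_coef /= invr1 mul1r.
Unshelve. all: by end_near.
Qed.

(** The factor t ^+ k of the k-th term may come from the time or from iterating t *: T. This is what
    makes the time-one flow an exponential map in the sense of [is_exponential]. *)
Lemma lin_flow_scale T u (t : R) : lin_flow (t *: T) 1 u = lin_flow T t u.
Proof.
apply: vector_eq_functional => f; rewrite !functional_lin_flow /flow_fun.
congr (lim (_ @ \oo)); apply/funext => n; rewrite /pseries /series /=.
apply: eq_bigr => k _; rewrite expr1n mulr1 /flow_coef -mulrA; congr (_ * _).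
have -> : iter k (t *: T) u = t ^+ k *: iter k T u.
  elim: k => [|k IH]; first by rewrite scale1r.
  by rewrite !iterS IH scale_lfunE linearZ scalerA exprS.
by rewrite linearZ mulrC.
Qed.

End LinearFlow.

(** * Uniqueness of solutions, and vanishing of multilinear families *)

Section LinearODE.
Variable R : realType.
Implicit Types U V W : vectType R.

(** The curve s |-> exp((t - s)T) c(s) is constant: the two terms of its derivative cancel because T
    commutes with its flow. Comparing s = t with s = 0 gives the formula. *)
Lemma linear_ode_unique U (T : 'End(U)) (c : R -> U) :
  (forall t, has_velocity c t (T (c t))) ->
  forall t, c t = lin_flow T t (c 0).
Proof.
move=> hc t; pose p s := lin_flow T (t - s) (c s).
have hp s : has_velocity p s 0.
  rewrite [X in has_velocity _ _ X](_ : 0 =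
    - T (lin_flow T (t - s) (c s)) + lin_flow T (t - s) (T (c s))); last first.
    by rewrite lin_flow_commute addNr.
  apply: (has_velocity_app_fun (q := fun s => lin_flow T (t - s))
    (q' := fun x => - T (lin_flow T (t - s) x))) => //.
  - by move=> ?; exact: lin_flow_linear.
  - by move=> k a b; rewrite lin_flow_linear linearP opprD scalerN.
  - by move=> x; apply: (has_velocity_reverse (c := fun r => lin_flow T r x));
      exact: has_velocity_lin_flow.
have := has_velocity0_const hp t 0.
by rewrite /p subrr subr0 lin_flow0.
Qed.

(* s |-> q_s (exp((t - s)S) x) is constant. *)
Lemma linear_family_zero U W (S : 'End(U)) (q : R -> U -> W) :
  (forall t, linear (q t)) ->
  (forall t x, has_velocity (fun s => q s x) t (q t (S x))) ->
  (forall x, q 0 x = 0) -> forall t x, q t x = 0.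
Proof.
move=> ql hq q0 t x; pose p s := q s (lin_flow S (t - s) x).
have hp s : has_velocity p s 0.
  pose u s := lin_flow S (t - s) x.
  rewrite [X in has_velocity _ _ X](_ : 0 =
    q s (S (u s)) + q s (- S (u s))); last first.
    rewrite -(linfunE (S (u s)) (ql s)) -(linfunE (- _) (ql s)).
    by rewrite linearN subrr.
  apply: (has_velocity_app_fun (q := q) (q' := fun x => q s (S x))
    (u := u)) => //.
  - by move=> k a b; rewrite linearP ql.
  - apply: (has_velocity_reverse (c := fun r => lin_flow S r x)).
    exact: has_velocity_lin_flow.
have := has_velocity0_const hp t 0.
by rewrite /p subrr lin_flow0 q0.
Qed.

(* Transporting y along the flow of T removes the second term of the
   equation. *)
Lemma bilinear_family_zero U V W (S : 'End(U)) (T : 'End(V))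
    (q : R -> U -> V -> W) :
  (forall t x, linear (q t x)) -> (forall t y, linear (fun x => q t x y)) ->
  (forall t x y,
     has_velocity (fun s => q s x y) t (q t (S x) y + q t x (T y))) ->
  (forall x y, q 0 x y = 0) -> forall t x y, q t x y = 0.
Proof.
move=> q2 q1 hq q0 t x y.
pose v s := lin_flow T (t - s) y.
suff : q t x (v t) = 0 by rewrite /v subrr lin_flow0.
apply: (linear_family_zero (S := S)
  (q := fun s x => q s x (v s))) => [//|s u|//].
rewrite [X in has_velocity _ _ X](_ : _ =
  (q s (S u) (v s) + q s u (T (v s))) + q s u (- T (v s))); last first.
  rewrite -(linfunE (T (v s)) (q2 s u)) -(linfunE (- _) (q2 s u)).
  by rewrite linearN addrK.
apply: (has_velocity_app_fun (q := fun s => q s u)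
  (q' := fun z => q s (S u) z + q s u (T z)) (u := v)) => //.
- by move=> k a b; rewrite linearP !q2 scalerDr addrACA.
- apply: (has_velocity_reverse (c := fun r => lin_flow T r y)).
  exact: has_velocity_lin_flow.
Qed.

(** Letting the third argument run backwards along the flow of S cancels the third term of the
    equation and leaves the bilinear case. *)
Lemma trilinear_family_zero U W (S : 'End(U)) (q : R -> U -> U -> U -> W) :
  (forall t x y, linear (q t x y)) ->
  (forall t x z, linear (fun y => q t x y z)) ->
  (forall t y z, linear (fun x => q t x y z)) ->
  (forall t x y z, has_velocity (fun s => q s x y z) t
     (q t (S x) y z + q t x (S y) z + q t x y (S z))) ->
  (forall x y z, q 0 x y z = 0) -> forall t x y z, q t x y z = 0.
Proof.
move=> q3 q2 q1 hq q0 t x y z.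
pose v s := lin_flow S (t - s) z.
suff : q t x y (v t) = 0 by rewrite /v subrr lin_flow0.
apply: (bilinear_family_zero (S := S) (T := S)
  (q := fun s x y => q s x y (v s))) => [//|//|s a b|//].
rewrite [X in has_velocity _ _ X](_ : _ =
  (q s (S a) b (v s) + q s a (S b) (v s) + q s a b (S (v s)))
   + q s a b (- S (v s))); last first.
  rewrite -(linfunE (S (v s)) (q3 s a b)) -(linfunE (- _) (q3 s a b)).
  by rewrite linearN addrK.
apply: (has_velocity_app_fun (q := fun s => q s a b)
  (q' := fun z => q s (S a) b z + q s a (S b) z + q s a b (S z))
  (u := v)) => //.
- move=> k a' b'; rewrite linearP !q3.
  by apply: vec_eq => p pD _ _ pZ; rewrite !(pD, pZ); ring.
- apply: (has_velocity_reverse (c := fun r => lin_flow S r z)).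
  exact: has_velocity_lin_flow.
Qed.

End LinearODE.

(** The shape of the curve determines its velocity. The product rule comes last, for the case in
    which both the linear map and its argument move. *)
Ltac velocity := repeat first
  [ exact: has_velocity_const | apply: has_velocityD | apply: has_velocityN
  | match goal with H : _ |- _ => apply: H end
  | apply: has_velocity_eval | apply: has_velocity_lin
  | apply: has_velocity_app ].

Lemma has_velocity_eq (R : realType) (E : vectType R) (c : R -> E) (t : R) v w :
  has_velocity c t v -> v = w -> has_velocity c t w.
Proof. by move=> ? <-. Qed.

Ltac differentiate :=
  apply: has_velocity_eq; [by velocity | cbv beta].

Section LinearMaps.
Variables (R : realType) (U V W : vectType R).

Lemma linear_fun_id : linear (fun x : U => x).
Proof. by []. Qed.

Lemma linear_fun_add (f h : U -> V) :
  linear f -> linear h -> linear (fun x => f x + h x).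
Proof. by move=> fl hl k x y; rewrite fl hl scalerDr addrACA. Qed.

Lemma linear_fun_opp (f : U -> V) : linear f -> linear (fun x => - f x).
Proof. by move=> fl k x y; rewrite fl opprD scalerN. Qed.

Lemma linear_fun_lfun (f : 'Hom(V, W)) (h : U -> V) :
  linear h -> linear (fun x => f (h x)).
Proof. by move=> hl k x y; rewrite hl linearP. Qed.

Lemma linear_fun_eval (h : U -> 'Hom(V, W)) (v : V) :
  linear h -> linear (fun x => h x v).
Proof. by move=> hl k x y; rewrite hl add_lfunE scale_lfunE. Qed.

End LinearMaps.

Ltac linmap := repeat first
  [ exact: linear_fun_id | apply: linear_fun_add | apply: linear_fun_opp
  | apply: linear_fun_lfun | apply: linear_fun_eval ].

(* Stated for plain functions, which [ring] handles much faster than bundled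
   linear maps. *)
Lemma flow_l3_aux (R : realType) (V0 V1 : vectType R)
    (b0 : V0 -> V0 -> V0) (b1 : V0 -> V1 -> V1) (m : V0 -> V0 -> V0 -> V1)
    (a0 X0 : V0 -> V0) (a1 X1 : V1 -> V1) (a2 l : V0 -> V0 -> V1) :
  (forall x a b, b1 x (a + b) = b1 x a + b1 x b) ->
  (forall x a, b1 x (- a) = - b1 x a) ->
  (forall a b, a1 (a + b) = a1 a + a1 b) ->
  (forall a, a1 (- a) = - a1 a) ->
  (forall x y z, m x y z = m y z x) ->
  (forall x y, l x y = - l y x) ->
  (forall u v w, a2 (X0 (b0 u v)) w =
     b1 (a0 w) (a1 (l u v)) - a1 (b1 w (l u v))
     + a2 (b0 (X0 u) v) w + a2 (b0 u (X0 v)) w) ->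
  (forall x y z, X1 (m x y z) =
     (l x (b0 y z) + b1 x (l y z) + m (X0 x) y z)
   + (l y (b0 z x) + b1 y (l z x) + m (X0 y) z x)
   + (l z (b0 x y) + b1 z (l x y) + m (X0 z) x y)) ->
  let a2' x y := a2 (X0 x) y + a2 x (X0 y) + a1 (l x y) in
  let q x y z := b1 (a0 x) (a2 y z) + b1 (a0 y) (a2 z x) + b1 (a0 z) (a2 x y)
    + m (a0 x) (a0 y) (a0 z)
    - (a2 (b0 x y) z + a2 (b0 y z) x + a2 (b0 z x) y + a1 (m x y z)) in
  forall x y z,
  b1 (a0 (X0 x)) (a2 y z) + b1 (a0 x) (a2' y z)
  + (b1 (a0 (X0 y)) (a2 z x) + b1 (a0 y) (a2' z x))
  + (b1 (a0 (X0 z)) (a2 x y) + b1 (a0 z) (a2' x y))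
  + (m (a0 (X0 x)) (a0 y) (a0 z) + m (a0 x) (a0 (X0 y)) (a0 z)
     + m (a0 x) (a0 y) (a0 (X0 z)))
  - (a2' (b0 x y) z + a2' (b0 y z) x + a2' (b0 z x) y + a1 (X1 (m x y z)))
  = q (X0 x) y z + q x (X0 y) z + q x y (X0 z).
Proof.
move=> b1D b1N a1D a1N m_rot lskew e h a2' q x y z; rewrite {}/a2' {}/q.
(* [e] and [h] carry the derivation inside the brackets and inside m. The two sides then differ only
   by the skew-symmetry of l and the cyclic symmetry of m. *)
rewrite !e h (lskew (b0 x y)) (lskew (b0 y z)) (lskew (b0 z x)).
rewrite (m_rot x (X0 y) z) -(m_rot (X0 z) x y) !(b1D, b1N, a1D, a1N).
by apply: vec_eq => p pD pN p0 pZ; rewrite !(pD, pN); ring.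
Qed.

(** * Automorphisms and derivations *)

Section Automorphisms.
Variables (R : realType) (V0 V1 : vectType R) (g : lie2_algebra V0 V1).

Local Notation E0 := ('End(V0) * 'End(V1) * 'Hom(V0, 'Hom(V0, V1)))%type.
Local Notation E1 := 'Hom(V0, V1).
Local Notation d := (lie2_d g).
Local Notation br0 := (lie2_br0 g).
Local Notation br1 := (lie2_br1 g).
Local Notation l3 := (lie2_l3 g).

Let linE := (lfun_D, lfun_N, lfun_0, lfun_Z, lfun_addE, lfun_oppE,
  lfun_scaleE, lfun_0E, lfun_compE, lfun_idE).

Local Ltac vring :=
  let p := fresh "p" in let pD := fresh in let pN := fresh in
  let p0 := fresh in let pZ := fresh in
  apply: vec_eq => p pD pN p0 pZ; rewrite ?(pD, pN, p0, pZ); ring.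

Local Ltac lin := by move=> *; linmap.

(** * Exponential curves in degree 0 *)

Lemma has_velocity_E0 (c : R -> E0) (t : R) (v : E0) :
  (forall x, has_velocity (fun s => (c s).1.1 x) t (v.1.1 x)) ->
  (forall a, has_velocity (fun s => (c s).1.2 a) t (v.1.2 a)) ->
  (forall x y, has_velocity (fun s => (c s).2 x y) t (v.2 x y)) ->
  has_velocity c t v.
Proof.
move=> h0 h1 h2; apply: has_velocity_pair; last first.
  by apply: has_velocity_lfun => x; apply: has_velocity_lfun => y.
by apply: has_velocity_pair; apply: has_velocity_lfun.
Qed.

(* The derivative at s = 0 of the product of A with 1 + s X on the right; with
   1 + s X on the left it would not be linear in A. *)
Definition aut0_field (X A : E0) : E0 :=
  ((A.1.1 \o X.1.1)%VF, (A.1.2 \o X.1.2)%VF,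
   bilfun (fun x y => A.2 (X.1.1 x) y + A.2 x (X.1.1 y) + A.1.2 (X.2 x y))).

Lemma aut0_fieldE X A x y : (aut0_field X A).2 x y =
  A.2 (X.1.1 x) y + A.2 x (X.1.1 y) + A.1.2 (X.2 x y).
Proof. by apply: bilfunE => ?; linmap. Qed.

Lemma aut0_field_linear X : linear (aut0_field X).
Proof.
move=> k A B; apply: E0_eq => [x|a|x y]; [by rewrite /= !linE..|].
rewrite -[RHS]/((k *: (aut0_field X A).2 + (aut0_field X B).2) x y).
by rewrite !lfun_addE !lfun_scaleE !aut0_fieldE /= !linE; vring.
Qed.

(** Defined for every X of the ambient space; the derivation equations are what keeps the flow
    inside the group. *)
Definition aut0_exp (X : E0) : E0 :=
  lin_flow (linfun (aut0_field X)) 1 (aut0_one V0 V1).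

Lemma aut0_expE X (t : R) :
  aut0_exp (t *: X) = lin_flow (linfun (aut0_field X)) t (aut0_one V0 V1).
Proof.
rewrite -lin_flow_scale /aut0_exp.
suff -> : linfun (aut0_field (t *: X)) = t *: linfun (aut0_field X) by [].
apply/lfunP => A.
rewrite scale_lfunE linfunE; last exact: aut0_field_linear.
rewrite linfunE; last exact: aut0_field_linear.
apply: E0_eq => [x|a|x y]; [by rewrite /= !linE..|].
rewrite -[RHS]/((t *: (aut0_field X A).2) x y).
by rewrite !lfun_scaleE !aut0_fieldE /= !linE; vring.
Qed.

Lemma aut0_exp0 X : aut0_exp (0 *: X) = aut0_one V0 V1.
Proof. by rewrite aut0_expE lin_flow0. Qed.

Lemma has_velocity_aut0_exp X (t : R) :
  has_velocity (fun s => aut0_exp (s *: X)) t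
    (aut0_field X (aut0_exp (t *: X))).
Proof.
under eq_fun do rewrite aut0_expE; rewrite aut0_expE.
rewrite -(linfunE _ (@aut0_field_linear X)).
exact: has_velocity_lin_flow.
Qed.

Lemma smooth_aut0_exp X : smooth_curve (fun t : R => aut0_exp (t *: X)).
Proof.
rewrite (_ : (fun t : R => aut0_exp (t *: X)) =
  (fun t => lin_flow (linfun (aut0_field X)) t (aut0_one V0 V1))).
  exact: smooth_lin_flow.
by apply/funext => t; exact: aut0_expE.
Qed.

Lemma aut0_field_one X : aut0_field X (aut0_one V0 V1) = X.
Proof.
apply: E0_eq => [x|a|x y]; [by rewrite /= !linE..|].
by rewrite aut0_fieldE /= !linE !add0r.
Qed.

Lemma has_velocity_aut0_exp0 X :
  has_velocity (fun s : R => aut0_exp (s *: X)) 0 X.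
Proof.
by have := has_velocity_aut0_exp X 0; rewrite aut0_exp0 aut0_field_one.
Qed.

Section Components.
Variables (c : R -> E0) (t : R) (v : E0).
Hypothesis hc : has_velocity c t v.

Lemma has_velocity_comp0 : has_velocity (fun s => (c s).1.1) t v.1.1.
Proof. exact/has_velocity_fst/has_velocity_fst. Qed.

Lemma has_velocity_comp1 : has_velocity (fun s => (c s).1.2) t v.1.2.
Proof. exact/has_velocity_snd/has_velocity_fst. Qed.

Lemma has_velocity_comp2 : has_velocity (fun s => (c s).2) t v.2.
Proof. exact/has_velocity_snd. Qed.

End Components.

Lemma has_velocity_aut0_mul (c e : R -> E0) (t : R) v w :
  has_velocity c t v -> has_velocity e t w ->
  has_velocity (fun s => aut0_mul (c s) (e s)) t
    (((v.1.1 \o (e t).1.1) + ((c t).1.1 \o w.1.1))%VF,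
     ((v.1.2 \o (e t).1.2) + ((c t).1.2 \o w.1.2))%VF,
     bilfun (fun x y =>
       v.2 ((e t).1.1 x) ((e t).1.1 y) + v.1.2 ((e t).2 x y)
       + (c t).2 (w.1.1 x) ((e t).1.1 y) + (c t).2 ((e t).1.1 x) (w.1.1 y)
       + (c t).1.2 (w.2 x y))).
Proof.
move=> hc he.
have c0 := has_velocity_comp0 hc; have c1 := has_velocity_comp1 hc.
have c2 := has_velocity_comp2 hc.
have e0 := has_velocity_comp0 he; have e1 := has_velocity_comp1 he.
have e2 := has_velocity_comp2 he.
apply: has_velocity_E0 => [x|a|x y].
- under eq_fun do rewrite comp_lfunE.
  by apply: has_velocity_eq; [velocity|rewrite /= !linE; vring].
- under eq_fun do rewrite comp_lfunE.
  by apply: has_velocity_eq; [velocity|rewrite /= !linE; vring].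
- under eq_fun do rewrite aut0_mulE.
  apply: has_velocity_eq; first by velocity.
  rewrite /= bilfunE ?linE; first by vring.
  + by move=> ?; linmap.
  + by move=> ?; linmap.
Qed.

(** Left multiplication by a fixed element preserves the vector field, so as functions of t both
    sides solve the same linear equation, with the same value exp(sX) at t = 0. *)
Lemma aut0_expD X (s t : R) :
  aut0_exp ((s + t) *: X) = aut0_mul (aut0_exp (s *: X)) (aut0_exp (t *: X)).
Proof.
have fl := aut0_field_linear X.
pose T := linfun (aut0_field X).
have h1 r : has_velocity (fun t => aut0_exp ((s + t) *: X)) r
    (T (aut0_exp ((s + r) *: X))).
  rewrite linfunE//.
  apply: (has_velocity_shift (c := fun r => aut0_exp (r *: X))).
  exact: has_velocity_aut0_exp.
have h2 r : has_velocity
    (fun t => aut0_mul (aut0_exp (s *: X)) (aut0_exp (t *: X))) r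
    (T (aut0_mul (aut0_exp (s *: X)) (aut0_exp (r *: X)))).
  rewrite linfunE//; apply: has_velocity_eq.
    apply: has_velocity_aut0_mul; first exact: has_velocity_const.
    exact: has_velocity_aut0_exp.
  move: (aut0_exp _) (aut0_exp _) => A B; apply: E0_eq => [x|a|x y].
  - by rewrite /= !linE add0r.
  - by rewrite /= !linE add0r.
  - rewrite aut0_fieldE !aut0_mulE /= bilfunE.
    + by rewrite aut0_fieldE !linE; vring.
    + by move=> ?; linmap.
    + by move=> ?; linmap.
rewrite (linear_ode_unique h1 t) (linear_ode_unique h2 t).
by rewrite addr0 aut0_exp0 aut0_mul1r.
Qed.

(** * The exponential of a derivation is an automorphism *)

Lemma aut0_flow_hom X (c : R -> E0) (t : R) : is_der g X ->
  (forall r, has_velocity c r (aut0_field X (c r))) ->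
  c 0 = aut0_one V0 V1 -> is_hom g (c t).
Proof.
move=> hX cv cE; move: t.
have c0 t := has_velocity_comp0 (cv t); have c1 t := has_velocity_comp1 (cv t).
have c2 t := has_velocity_comp2 (cv t).
(* The order of the five equations matters: the one for [br0] relies on the compatibility with d,
   and the one for [l3] on skew-symmetry and on the equation for [br1]. *)
have skew t x y : (c t).2 x y = - (c t).2 y x.
  apply/eqP; rewrite -addr_eq0; apply/eqP; move: t x y.
  apply: (bilinear_family_zero (S := X.1.1) (T := X.1.1)
    (q := fun t x y => (c t).2 x y + (c t).2 y x)).
  - lin.
  - lin.
  - move=> t x y; differentiate.
    rewrite !aut0_fieldE (der_skew hX y x) !linE; vring.
  - by move=> x y; rewrite cE /= !linE addr0.
have cd t a : d ((c t).1.2 a) = (c t).1.1 (d a).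
  apply/eqP; rewrite -subr_eq0; apply/eqP; move: t a.
  apply: (linear_family_zero (S := X.1.2)
    (q := fun t a => d ((c t).1.2 a) - (c t).1.1 (d a))).
  - lin.
  - move=> t a; differentiate.
    by rewrite /= !linE (der_dE hX) ?(add0r, addr0).
  - by move=> a; rewrite cE /= !linE subrr.
have cbr0 t x y :
    (c t).1.1 (br0 x y) - br0 ((c t).1.1 x) ((c t).1.1 y) = d ((c t).2 x y).
  apply/eqP; rewrite -subr_eq0; apply/eqP; move: t x y.
  apply: (bilinear_family_zero (S := X.1.1) (T := X.1.1)
    (q := fun t x y => (c t).1.1 (br0 x y)
      - br0 ((c t).1.1 x) ((c t).1.1 y) - d ((c t).2 x y))).
  - lin.
  - lin.
  - move=> t x y; differentiate.
    rewrite !aut0_fieldE /= !linE cd (der_br0 hX) !linE; vring.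
  - by move=> x y; rewrite cE /= !linE subrr subrr.
have cbr1 t x a :
    (c t).1.2 (br1 x a) - br1 ((c t).1.1 x) ((c t).1.2 a) = (c t).2 x (d a).
  apply/eqP; rewrite -subr_eq0; apply/eqP; move: t x a.
  apply: (bilinear_family_zero (S := X.1.1) (T := X.1.2)
    (q := fun t x a => (c t).1.2 (br1 x a)
      - br1 ((c t).1.1 x) ((c t).1.2 a) - (c t).2 x (d a))).
  - lin.
  - lin.
  - move=> t x a; differentiate.
    rewrite !aut0_fieldE /= !linE (der_dE hX) (der_br1 hX) !linE; vring.
  - by move=> x a; rewrite cE /= !linE subrr subrr.
have cl3 t x y z :
    br1 ((c t).1.1 x) ((c t).2 y z) + br1 ((c t).1.1 y) ((c t).2 z x)
      + br1 ((c t).1.1 z) ((c t).2 x y)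
      + l3 ((c t).1.1 x) ((c t).1.1 y) ((c t).1.1 z)
    = (c t).2 (br0 x y) z + (c t).2 (br0 y z) x + (c t).2 (br0 z x) y
      + (c t).1.2 (l3 x y z).
  apply/eqP; rewrite -subr_eq0; apply/eqP; move: t x y z.
  apply: (trilinear_family_zero (S := X.1.1)
    (q := fun t x y z =>
      br1 ((c t).1.1 x) ((c t).2 y z) + br1 ((c t).1.1 y) ((c t).2 z x)
      + br1 ((c t).1.1 z) ((c t).2 x y)
      + l3 ((c t).1.1 x) ((c t).1.1 y) ((c t).1.1 z)
      - ((c t).2 (br0 x y) z + (c t).2 (br0 y z) x + (c t).2 (br0 z x) y
      + (c t).1.2 (l3 x y z)))).
  - lin.
  - lin.
  - lin.
  - move=> t x y z; differentiate.
    (* By [der_br0], X_0[u, v] is [X_0 u, v] + [u, X_0 v] plus d of l_X(u, v). On the image of d,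
       the component A_2 is known from [cbr1], up to exchanging its arguments. *)
    have e u v w : (c t).2 (X.1.1 (br0 u v)) w =
        br1 ((c t).1.1 w) ((c t).1.2 (X.2 u v)) - (c t).1.2 (br1 w (X.2 u v))
        + (c t).2 (br0 (X.1.1 u) v) w + (c t).2 (br0 u (X.1.1 v)) w.
      have := cbr1 t w (X.2 u v); rewrite skew (der_br0 hX) !linE => H.
      apply: vec_eq => p pD pN _ _; move/(congr1 p): H.
      by rewrite !(pD, pN); lra.
    rewrite lfun_addE !aut0_fieldE /= !comp_lfunE.
    apply: (flow_l3_aux (b0 := fun u v => br0 u v) (b1 := fun u a => br1 u a)
      (m := fun u v w => l3 u v w) (a0 := fun u => (c t).1.1 u)
      (X0 := fun u => X.1.1 u) (a1 := fun a => (c t).1.2 a)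
      (X1 := fun a => X.1.2 a) (a2 := fun u v => (c t).2 u v)
      (l := fun u v => X.2 u v));
      try by [move=> *; rewrite !linE | exact: l3_rot].
    + exact: (der_skew hX).
    + exact: e.
    + exact: (der_l3 hX).
  - move=> x y z; rewrite cE /= !linE; vring.
move=> t; split; [exact: skew| |exact: cbr0|exact: cbr1|exact: cl3].
by apply/lfunP => a; rewrite !linE; exact: cd.
Qed.

Lemma aut0_exp_mulV X (t : R) :
  aut0_mul (aut0_exp (t *: X)) (aut0_exp (- t *: X)) = aut0_one V0 V1 /\
  aut0_mul (aut0_exp (- t *: X)) (aut0_exp (t *: X)) = aut0_one V0 V1.
Proof. by split; rewrite -aut0_expD (subrr, addNr) aut0_exp0. Qed.

(** The linear components of exp(-tX) invert those of exp(tX), by the one-parameter property. *)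
Lemma aut0_exp_in X (t : R) : is_der g X -> aut0 g (aut0_exp (t *: X)).
Proof.
move=> hX.
have hom : is_hom g (aut0_exp (t *: X)).
  apply: (aut0_flow_hom (c := fun t => aut0_exp (t *: X)) _ hX).
    exact: has_velocity_aut0_exp.
  exact: aut0_exp0.
have [] := aut0_exp_mulV X t; move: hom.
move: (aut0_exp (t *: X)) (aut0_exp (- t *: X)) => A B hom AB BA.
split=> //.
- exists B.1.1; split.
    by rewrite -[LHS]/(aut0_mul A B).1.1 AB.
  by rewrite -[LHS]/(aut0_mul B A).1.1 BA.
- exists B.1.2; split.
    by rewrite -[LHS]/(aut0_mul A B).1.2 AB.
  by rewrite -[LHS]/(aut0_mul B A).1.2 BA.
Qed.

(** * The Lie algebra of the degree 0 group: tangent space and bracket *)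

Lemma vanishing_velocity (E : vectType R) (q : R -> E) (t : R) v :
  (forall s, q s = 0) -> has_velocity q t v -> v = 0.
Proof.
move=> q0 hq; apply: (has_velocity_unique hq).
by rewrite (_ : q = fun=> 0); [exact: has_velocity_const|exact/funext].
Qed.

Lemma hom_curve_der (c : R -> E0) X : (forall t, is_hom g (c t)) ->
  c 0 = aut0_one V0 V1 -> has_velocity c 0 X -> is_der g X.
Proof.
move=> hc cE cv.
have c0 := has_velocity_comp0 cv; have c1 := has_velocity_comp1 cv.
have c2 := has_velocity_comp2 cv.
have vanish (E : vectType R) (q q' : R -> E) v : (forall s, q s = q' s) ->
    has_velocity (fun s => q s - q' s) 0 v -> v = 0.
  by move=> qq'; apply: vanishing_velocity => s; rewrite qq' subrr.
split.
- move=> x y; have := vanish _ _ _ _ (fun s => hom_skew (hc s) x y).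
  move=> /(_ (X.2 x y - - X.2 y x)) H; apply/eqP; rewrite -subr_eq0.
  by apply/eqP/H; velocity.
- apply/lfunP => a; rewrite !comp_lfunE.
  apply/eqP; rewrite -subr_eq0; apply/eqP.
  apply: (vanish _ (fun s => (c s).1.1 (d a)) (fun s => d ((c s).1.2 a))).
    by move=> s; rewrite (hom_dE (hc s)).
  by velocity.
- move=> x y; apply/esym/eqP; rewrite -subr_eq0; apply/eqP.
  apply: (vanish _ _ _ _ (fun s => hom_br0 (hc s) x y)).
  differentiate; rewrite cE /= !linE; vring.
- move=> x a; apply/esym/eqP; rewrite -subr_eq0; apply/eqP.
  apply: (vanish _ _ _ _ (fun s => hom_br1 (hc s) x a)).
  differentiate; rewrite cE /= !linE; vring.
- move=> x y z; apply/eqP; rewrite -subr_eq0; apply/eqP.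
  have skew u w : X.2 u w = - X.2 w u.
    have := vanish _ _ _ _ (fun s => hom_skew (hc s) u w).
    move=> /(_ (X.2 u w - - X.2 w u)) H; apply/eqP; rewrite -subr_eq0.
    by apply/eqP/H; velocity.
  apply: (vanish _ _ _ _ (fun s => esym (hom_l3 (hc s) x y z))).
  differentiate; rewrite cE /= !linE.
  (* The brackets sit in the second slot of l_X in [der_l3] but in the first slot of A_2 in
     [hom_l3]. Skew-symmetry and the cyclic symmetry of [l3] reconcile the two forms. *)
  rewrite (skew x (br0 y z)) (skew y (br0 z x)) (skew z (br0 x y)).
  rewrite (l3_rot g x (X.1.1 y) z) (l3_rot g (X.1.1 z) x y).
  vring.
Qed.

Lemma aut0_tangent : tangent_space (aut0_group g) = der0 g.
Proof.
apply/seteqP; split=> X /=.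
  move=> [c [cin _ c0 cv]]; apply: hom_curve_der c0 cv => t.
  by have [] := cin t.
move=> hX; exists (fun t => aut0_exp (t *: X)); split.
- by move=> t; exact: aut0_exp_in.
- exact: smooth_aut0_exp.
- exact: aut0_exp0.
- exact: has_velocity_aut0_exp0.
Qed.

Lemma aut0_is_exponential :
  is_exponential (aut0_group g) aut0_exp.
Proof.
rewrite /is_exponential aut0_tangent => X hX; split.
- by move=> t; exact: aut0_exp_in.
- by move=> s t; exact: aut0_expD.
- exact: smooth_aut0_exp.
- exact: has_velocity_aut0_exp0.
Qed.

(** For A = exp(tX) and C = exp(-tX) the velocity is Ad(exp(tX)) Y, the inner derivative in the
    definition of the bracket. *)
Lemma has_velocity_aut0_conj (A C : E0) (B : R -> E0) Y :
  B 0 = aut0_one V0 V1 -> has_velocity B 0 Y ->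
  has_velocity (fun s => aut0_mul (aut0_mul A (B s)) C) 0
    ((A.1.1 \o Y.1.1 \o C.1.1)%VF, (A.1.2 \o Y.1.2 \o C.1.2)%VF,
     bilfun (fun x y =>
       A.2 (Y.1.1 (C.1.1 x)) (C.1.1 y) + A.2 (C.1.1 x) (Y.1.1 (C.1.1 y))
       + A.1.2 (Y.2 (C.1.1 x) (C.1.1 y)) + A.1.2 (Y.1.2 (C.2 x y)))).
Proof.
move=> BE hB.
have B0 := has_velocity_comp0 hB; have B1 := has_velocity_comp1 hB.
have B2 := has_velocity_comp2 hB.
apply: has_velocity_E0 => [x|a|x y].
- rewrite /= !comp_lfunE; under eq_fun do rewrite !comp_lfunE.
  by velocity.
- rewrite /= !comp_lfunE; under eq_fun do rewrite !comp_lfunE.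
  by velocity.
- under eq_fun do rewrite !aut0_mulE /= comp_lfunE.
  differentiate; rewrite BE /= bilfunE ?linE // => ?; linmap.
Qed.

(** The outer derivative, where C plays the inverse of A and so moves with velocity -X. At the
    identity the product rule leaves the two commutators and L_X l_Y - L_Y l_X. *)
Lemma has_velocity_aut0_Ad (A C : R -> E0) (X Y : E0) :
  A 0 = aut0_one V0 V1 -> C 0 = aut0_one V0 V1 ->
  has_velocity A 0 X -> has_velocity C 0 (- X) ->
  has_velocity (fun t =>
    (((A t).1.1 \o Y.1.1 \o (C t).1.1)%VF, ((A t).1.2 \o Y.1.2 \o (C t).1.2)%VF,
     bilfun (fun x y =>
       (A t).2 (Y.1.1 ((C t).1.1 x)) ((C t).1.1 y)
       + (A t).2 ((C t).1.1 x) (Y.1.1 ((C t).1.1 y))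
       + (A t).1.2 (Y.2 ((C t).1.1 x) ((C t).1.1 y))
       + (A t).1.2 (Y.1.2 ((C t).2 x y)))) : E0) 0 (der0_br X Y).
Proof.
move=> AE CE hA hC.
have A0 := has_velocity_comp0 hA; have A1 := has_velocity_comp1 hA.
have A2 := has_velocity_comp2 hA.
have C0 := has_velocity_comp0 hC; have C1 := has_velocity_comp1 hC.
have C2 := has_velocity_comp2 hC.
apply: has_velocity_E0 => [x|a|x y] /=.
- under eq_fun do rewrite !comp_lfunE.
  by differentiate; rewrite AE CE /= !linE.
- under eq_fun do rewrite !comp_lfunE.
  by differentiate; rewrite AE CE /= !linE.
- have e t : bilfun (fun x y =>
       (A t).2 (Y.1.1 ((C t).1.1 x)) ((C t).1.1 y)
       + (A t).2 ((C t).1.1 x) (Y.1.1 ((C t).1.1 y))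
       + (A t).1.2 (Y.2 ((C t).1.1 x) ((C t).1.1 y))
       + (A t).1.2 (Y.1.2 ((C t).2 x y))) x y =
       (A t).2 (Y.1.1 ((C t).1.1 x)) ((C t).1.1 y)
       + (A t).2 ((C t).1.1 x) (Y.1.1 ((C t).1.1 y))
       + (A t).1.2 (Y.2 ((C t).1.1 x) ((C t).1.1 y))
       + (A t).1.2 (Y.1.2 ((C t).2 x y)).
    by rewrite bilfunE // => ?; linmap.
  under eq_fun do rewrite e.
  rewrite -[bilfun _ x y]/((der0_br X Y).2 x y) der0_brE /der_L.
  differentiate; rewrite AE CE /= !linE; vring.
Qed.

Lemma has_velocity_aut0_expN (X : E0) :
  has_velocity (fun t : R => aut0_exp (- t *: X)) 0 (- X).
Proof.
under eq_fun do rewrite -[- _]add0r.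
apply: (has_velocity_reverse (c := fun t => aut0_exp (t *: X))).
by rewrite subrr; exact: has_velocity_aut0_exp0.
Qed.

Lemma aut0_is_lie_algebra :
  is_lie_algebra_of (aut0_group g) aut0_exp (der0_algebra g).
Proof.
split; first by rewrite aut0_tangent.
move=> X Y _ _; eexists; split.
  move=> t; apply: has_velocity_aut0_conj; first exact: aut0_exp0.
  exact: has_velocity_aut0_exp0.
apply: (has_velocity_aut0_Ad (A := fun t => aut0_exp (t *: X))
  (C := fun t => aut0_exp (- t *: X))).
- exact: aut0_exp0.
- by rewrite oppr0 aut0_exp0.
- exact: has_velocity_aut0_exp0.
- exact: has_velocity_aut0_expN.
Qed.

(** * The exponential map and the Lie algebra in degree -1 *)

(* The derivative at s = 0 of the product of t with s T on the right, made
   linear in t by adjoining a coordinate that stays equal to 1. *)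
Definition aut1_field (T : E1) (u : R^o * E1) : R^o * E1 :=
  (0, u.1 *: T + (u.2 \o d \o T)%VF).

Lemma aut1_field_linear T : linear (aut1_field T).
Proof.
move=> k u v; congr (_, _); first by rewrite /= scaler0 addr0.
rewrite -[(k *: u + v).1]/(k * u.1 + v.1).
by apply/lfunP => x; rewrite /= !linE; vring.
Qed.

(** The starting point (1, 0) is the unit 0 of the group together with the adjoined coordinate 1. *)
Definition aut1_exp (T : E1) : E1 :=
  (lin_flow (linfun (aut1_field T)) 1 (1, 0)).2.

Lemma aut1_flow_scale T (t : R) :
  lin_flow (linfun (aut1_field (t *: T))) 1 (1, 0) =
  lin_flow (linfun (aut1_field T)) t (1, 0).
Proof.
rewrite -[RHS]lin_flow_scale.
suff -> : linfun (aut1_field (t *: T)) = t *: linfun (aut1_field T) by [].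
apply/lfunP => u.
rewrite scale_lfunE linfunE; last exact: aut1_field_linear.
rewrite linfunE; last exact: aut1_field_linear.
congr (_, _); first by rewrite /= scaler0.
by apply/lfunP => x; rewrite /= !linE; vring.
Qed.

Lemma aut1_expE T (t : R) :
  aut1_exp (t *: T) = (lin_flow (linfun (aut1_field T)) t (1, 0)).2.
Proof. by rewrite /aut1_exp aut1_flow_scale. Qed.

Lemma aut1_exp0 T : aut1_exp (0 *: T) = 0.
Proof. by rewrite aut1_expE lin_flow0. Qed.

Lemma smooth_aut1_exp T : smooth_curve (fun t : R => aut1_exp (t *: T)).
Proof.
have l2 : linear (snd : R^o * E1 -> E1) by [].
have := @smooth_curve_lin R _ _ (linfun (snd : R^o * E1 -> E1)) _
  (@smooth_lin_flow R _ (linfun (aut1_field T)) (1, 0)).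
by congr smooth_curve; apply/funext => s; rewrite linfunE// aut1_expE.
Qed.

Lemma has_velocity_aut1_exp T (t : R) :
  has_velocity (fun s => aut1_exp (s *: T)) t
    (T + (aut1_exp (t *: T) \o d \o T)%VF).
Proof.
pose L := linfun (aut1_field T).
have Lu u : L u = aut1_field T u by rewrite linfunE//; exact: aut1_field_linear.
have hu s := has_velocity_lin_flow L (1, 0) s.
(* The adjoined coordinate has velocity 0 and keeps its initial value 1, which gives back the affine
   equation. *)
have k1 s : (lin_flow L s (1, 0)).1 = 1.
  have h r : has_velocity (fun s => (lin_flow L s (1, 0)).1) r 0.
    by have := has_velocity_fst (hu r); rewrite Lu.
  by rewrite (has_velocity0_const h s 0) lin_flow0.
under eq_fun do rewrite aut1_expE; rewrite aut1_expE -/L.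
have := has_velocity_snd (hu t); rewrite Lu /= k1 scale1r.
exact.
Qed.

Lemma has_velocity_aut1_exp0 T :
  has_velocity (fun s : R => aut1_exp (s *: T)) 0 T.
Proof.
have := has_velocity_aut1_exp T 0; rewrite aut1_exp0.
by rewrite !comp_lfun0l addr0.
Qed.

Lemma has_velocity_aut1_mul (c e : R -> E1) (t : R) v w :
  has_velocity c t v -> has_velocity e t w ->
  has_velocity (fun s => aut1_mul g (c s) (e s)) t
    (v + w + ((v \o d \o e t) + (c t \o d \o w))%VF).
Proof.
move=> hc he; apply: has_velocity_lfun => x.
under eq_fun do rewrite /aut1_mul !linE.
by differentiate; rewrite !linE.
Qed.

Lemma has_velocity_aut1_expN (T : E1) :
  has_velocity (fun t : R => aut1_exp (- t *: T)) 0 (- T).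
Proof.
under eq_fun do rewrite -[- _]add0r.
apply: (has_velocity_reverse (c := fun t => aut1_exp (t *: T))).
by rewrite subrr; exact: has_velocity_aut1_exp0.
Qed.

(** Both sides solve the same affine equation in t with the same initial value. [hL] adjoins the
    constant 1 to make it linear, so that uniqueness applies. *)
Lemma aut1_expD T (s t : R) :
  aut1_exp ((s + t) *: T) = aut1_mul g (aut1_exp (s *: T)) (aut1_exp (t *: T)).
Proof.
pose L := linfun (aut1_field T).
have Lu u : L u = aut1_field T u by rewrite linfunE//; exact: aut1_field_linear.
have hL (c : R -> E1) :
    (forall r, has_velocity c r (T + (c r \o d \o T)%VF)) ->
    forall r, has_velocity (fun r => (1, c r) : R^o * E1) r (L (1, c r)).
  move=> hc r; rewrite Lu; apply: has_velocity_pair => /=.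
    exact: has_velocity_const.
  by rewrite scale1r.
have h1 := hL (fun t => aut1_exp ((s + t) *: T)) (fun r =>
  has_velocity_shift (c := fun r => aut1_exp (r *: T))
    (has_velocity_aut1_exp T (s + r))).
have h2 : forall r, has_velocity
    (fun t => aut1_mul g (aut1_exp (s *: T)) (aut1_exp (t *: T))) r
    (T + (aut1_mul g (aut1_exp (s *: T)) (aut1_exp (r *: T)) \o d \o T)%VF).
  move=> r; apply: has_velocity_eq.
    apply: has_velocity_aut1_mul; first exact: has_velocity_const.
    exact: has_velocity_aut1_exp.
  move: (aut1_exp _) (aut1_exp _) => A B.
  by apply/lfunP => x; rewrite /aut1_mul !linE; vring.
move/hL in h2.
have := congr1 snd (linear_ode_unique h1 t).
have := congr1 snd (linear_ode_unique h2 t).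
by rewrite addr0 aut1_exp0 aut1_mul0r /= => -> ->.
Qed.

Lemma aut1_exp_in T (t : R) : aut1 g (aut1_exp (t *: T)).
Proof.
exists (aut1_exp (- t *: T)).
by split; rewrite -aut1_expD (subrr, addNr) aut1_exp0.
Qed.

Lemma aut1_tangent : tangent_space (aut1_group g) = setT.
Proof.
apply/seteqP; split=> // T _; exists (fun t => aut1_exp (t *: T)); split.
- by move=> t; exact: aut1_exp_in.
- exact: smooth_aut1_exp.
- exact: aut1_exp0.
- exact: has_velocity_aut1_exp0.
Qed.

Lemma aut1_is_exponential : is_exponential (aut1_group g) aut1_exp.
Proof.
move=> T _; split.
- by move=> t; exact: aut1_exp_in.
- by move=> s t; exact: aut1_expD.
- exact: smooth_aut1_exp.
- exact: has_velocity_aut1_exp0.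
Qed.

Lemma aut1_is_lie_algebra :
  is_lie_algebra_of (aut1_group g) aut1_exp (der1_algebra g).
Proof.
split; first by rewrite aut1_tangent.
move=> S T _ _.
(* The curve is Ad applied to T, namely (1 + A d) T (1 + d C) multiplied out, with C in the role of
   the inverse of A. *)
have Ad (A C : R -> E1) : A 0 = 0 -> C 0 = 0 ->
    has_velocity A 0 S -> has_velocity C 0 (- S) ->
    has_velocity (fun t => T + (A t \o d \o T)%VF + (T \o d \o C t)%VF
      + (A t \o d \o T \o d \o C t)%VF) 0 (der1_br g S T).
  move=> A0 C0 hA hC; apply: has_velocity_lfun => x.
  under eq_fun do rewrite !linE.
  by differentiate; rewrite A0 C0 /der1_br !linE; vring.
(* Treating the outer derivative first fixes the inner velocity to the closed form of [Ad], which
   the inner derivative then has to match. *)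
eexists; split; last first.
  apply: (Ad (fun t => aut1_exp (t *: S)) (fun t => aut1_exp (- t *: S))).
  - exact: aut1_exp0.
  - by rewrite oppr0 aut1_exp0.
  - exact: has_velocity_aut1_exp0.
  - exact: has_velocity_aut1_expN.
move=> t; apply: has_velocity_eq.
  apply: has_velocity_aut1_mul; last exact: has_velocity_const.
  apply: has_velocity_aut1_mul; first exact: has_velocity_const.
  exact: has_velocity_aut1_exp0.
cbv beta; rewrite [aut1_exp (0 *: T)]aut1_exp0.
move: (aut1_exp _) (aut1_exp _) => B C.
by apply/lfunP => x; rewrite !linE; vring.
Qed.

(** * Differentials of the boundary map and of the action *)

Lemma aut_bd_differential :
  is_differential_at_one (aut1_group g) (aut_bd g) (der_bd g).
Proof.
move=> c v _ _ /= c0 hc; apply: has_velocity_E0 => [x|a|x y].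
- under eq_fun do rewrite /= !linE.
  by differentiate; rewrite /= !linE add0r.
- under eq_fun do rewrite /= !linE.
  by differentiate; rewrite /= !linE add0r.
(* The term [t x, d (t y)] of [aut_bd] is quadratic in t, so its derivative vanishes at the unit 0;
   this is why [der_bd] has no counterpart of it. *)
- rewrite der_bdE; under eq_fun do rewrite aut_bdE.
  by differentiate; rewrite c0 !linE; vring.
Qed.

Lemma aut_act_velocity X T :
  iterated_velocity
    (fun t s : R => aut_act (aut0_exp (t *: X)) (aut1_exp (s *: T)))
    (der_act X T).
Proof.
(* The inverse inside [aut_act] is replaced by a component of exp(-tX), a curve whose velocity is
   known. *)
have inv t : ((aut0_exp (t *: X)).1.1^-1)%VF = (aut0_exp (- t *: X)).1.1.
  have [] := aut0_exp_mulV X t.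
  move: (aut0_exp (t *: X)) (aut0_exp (- t *: X)) => A B AB BA.
  apply: lfun_invV.
    by rewrite -[LHS]/(aut0_mul A B).1.1 AB.
  by rewrite -[LHS]/(aut0_mul B A).1.1 BA.
have act (A C : R -> E0) : A 0 = aut0_one V0 V1 -> C 0 = aut0_one V0 V1 ->
    has_velocity A 0 X -> has_velocity C 0 (- X) ->
    has_velocity (fun t => (A t).1.2 \o T \o (C t).1.1)%VF 0 (der_act X T).
  move=> AE CE /has_velocity_comp1 A1 /has_velocity_comp0 C0.
  apply: has_velocity_lfun => x; under eq_fun do rewrite !linE.
  by differentiate; rewrite AE CE /= /der_act !linE.
eexists; split; last first.
  apply: (act (fun t => aut0_exp (t *: X)) (fun t => aut0_exp (- t *: X))).
  - exact: aut0_exp0.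
  - by rewrite oppr0 aut0_exp0.
  - exact: has_velocity_aut0_exp0.
  - exact: has_velocity_aut0_expN.
move=> t; under eq_fun do rewrite /aut_act inv.
move: (aut0_exp _) (aut0_exp _) => A B; apply: has_velocity_lfun => x.
under eq_fun do rewrite !comp_lfunE.
rewrite !comp_lfunE; apply: has_velocity_lin; apply: has_velocity_eval.
exact: has_velocity_aut1_exp0.
Qed.

End Automorphisms.

Theorem theorem5p1 (R : realType) (V0 V1 : vectType R)
    (g : lie2_algebra V0 V1) :
  is_differentiation (aut_crossed_module g) (der_crossed_module g).
Proof.
exists (@aut1_exp R V0 V1 g), (@aut0_exp R V0 V1); split.
- by split; [exact: aut1_is_exponential|exact: aut0_is_exponential].
- exact: aut1_is_lie_algebra.
- exact: aut0_is_lie_algebra.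
- exact: aut_bd_differential.
- by move=> X T _ _; exact: aut_act_velocity.
Qed.
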